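(* Fix $\kappa\in(0,1/3)$. There exist $C>0$ and an integer $L_0\ge1$ such that for all $L\ge L_0$ and all $x_0\in Q_{R_L-r_L}$, on the event $E_{L,x_0}=E_{L,x_0}(\kappa)$, $$\big|\lambda_1(Q_{R_L},\xi_L)-\bar\lambda_L-\Xi_L(x_0)\big|\le C\frac{d_L}{a_L}\Big(\Big(\frac{d_L}{a_L}\Big)^{1-2\kappa}|\xi_L(x_0)-a_L|+\frac1{a_L}\Big),$$ and $$\|\varphi_{R_L}-\bar\varphi_L(\cdot-x_0)\|_{\ell^2(Q_{R_L})}\le C\frac{d_L}{a_L}\sqrt{\Big(\frac{d_L}{a_L}\Big)^{1-2\kappa}|\xi_L(x_0)-a_L|+\frac1{a_L}},$$ where $\bar\varphi_L$ is extended by $0$ outside $Q_{r_L}$.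
   Context: Fix $d\ge1$; $|x|$ Euclidean norm; $Q_a=[-a/2,a/2]^d\cap\mathbb{Z}^d$, $Q_{a,x}=x+Q_a$, $Q_a^{\neq0}=Q_a\setminus\{0\}$; $u_L\ll v_L$ means $u_L/v_L\to0$. For each $L\ge1$, $(\xi_L(x))_{x\in\mathbb{Z}^d}$ is a centred shift-stationary Gaussian field with unit variance and non-negative covariance $v_L$ with (I) $\sup_{|x|\ge\exp(\sqrt{\ln L})}v_L(x)\ln|x|\to0$; (II) there are $\mathfrak c,\mathfrak c'>0$ with $1-e^{\mathfrak c'|x|}/d_L\le v_L(x)\le1-\mathfrak c/d_L$ for all $L,x\ne0$, where $\sup_{|x|=1}v_L(x)=1-1/d_L$. $a_L$: $\mathbb{P}(\xi_L(0)>a_L)=L^{-d}$. Fix $R_L,r_L$ with $a_L\ll\ln R_L\ll a_L^2/d_L$, $\ln a_L\le\ln r_L\ll\sqrt{a_L}$. $\Delta f(x)=\sum_{|y-x|=1}(f(y)-f(x))$; Dirichlet operators act on functions extended by $0$ outside the domain. $\lambda_1(Q_{R_L},\xi_L)$ and $\varphi_{R_L}\ge0$: principal eigenvalue and $\ell^2$-normalised eigenfunction of $\Delta+\xi_L$ on $Q_{R_L}$ (Dirichlet). $\mathcal{S}_L(x)=a_L(1-v_L(x))$; $\bar\lambda_L,\bar\varphi_L\ge0$: principal eigenvalue and normalised eigenfunction of $\Delta-\mathcal{S}_L$ on $Q_{r_L}$ (Dirichlet). $\zeta_{L,x_0}(x)=\xi_L(x)-\xi_L(x_0)v_L(x-x_0)$;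 $\Phi_L(y)=\sum_{x\in Q_{r_L}^{\neq0}}\bar\varphi_L(x)^2\zeta_{L,y}(x+y)$; $\tau_L^2=\mathrm{Var}(\Phi_L(y))$; $\Xi_L=\xi_L+\Phi_L$. Standing assumptions: $d_L\ll a_L$, $\tau_L\ll a_L^{-1}(a_L/d_L)^{1/2}$. With $\theta=2d+1$: $E_{L,x_0}(\kappa)=E^1\cap E^2\cap E^3$ with $E^1=\{|\xi_L(x_0)-a_L|<\theta\}$, $E^2=\{|\zeta_{L,x_0}(x)|\le\frac1{10}\mathcal{S}_L(x-x_0)\ \forall x\in Q_{2R_L,x_0}\}$, $E^3=\bigcap_{x\in Q_{R_L,x_0}\setminus\{x_0\}}\{|\zeta_{L,x_0}(x)|/\sqrt{\mathrm{Var}[\zeta_{L,x_0}(x)]}\le(a_L/d_L)^{\kappa|x-x_0|}\sqrt{1\vee(|\xi_L(x_0)-a_L|a_L)}\}$. *)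

(* Defs.v *)
From HB Require Import structures.
From mathcomp Require Import all_boot all_order all_algebra.
From mathcomp Require Import all_classical all_reals all_analysis.
Set Implicit Arguments.
Unset Strict Implicit.
Unset Printing Implicit Defensive.
Import Order.TTheory GRing.Theory Num.Theory.
Local Open Scope ring_scope.
Local Open Scope classical_set_scope.

Notation Zpt d := {ffun 'I_d -> int}.

Definition unitv (d : nat) (i : 'I_d) : Zpt d := [ffun j => ((i == j) : nat)%:Z].

Definition enorm {R : realType} (d : nat) (x : Zpt d) : R :=
  Num.sqrt (\sum_(i < d) ((x i)%:~R : R) ^+ 2).

(* x \in Q_a = [-a/2, a/2]^d \cap Z^d  (so x \in Q_{a,y} iff inbox a (x - y)). *)
Definition inbox {R : realType} (d : nat) (a : R) (x : Zpt d) : bool :=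
  [forall i, `|((x i)%:~R : R)| <= a / 2].

Definition cube (d N : nat) : seq (Zpt d) :=
  [seq [ffun i => (k i : nat)%:Z - N%:Z] | k : {ffun 'I_d -> 'I_(N.*2.+1)}].

Definition box {R : realType} (d : nat) (a : R) : seq (Zpt d) :=
  [seq x <- cube d `|Num.floor (`|a| / 2)|%N | inbox a x].

Definition lap {R : realType} (d : nat) (f : Zpt d -> R) (x : Zpt d) : R :=
  \sum_(i < d) ((f (x + unitv i) - f x) + (f (x - unitv i) - f x)).

Definition dirichlet_eigen {R : realType} (d : nat) (a : R) (V : Zpt d -> R)
    (lam : R) (f : Zpt d -> R) : Prop :=
  [/\ (forall x, ~~ inbox a x -> f x = 0),
      (exists x, f x != 0) &
      (forall x, inbox a x -> lap f x + V x * f x = lam * f x)].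

Definition principal_eigenpair {R : realType} (d : nat) (a : R) (V : Zpt d -> R)
    (lam : R) (f : Zpt d -> R) : Prop :=
  [/\ dirichlet_eigen a V lam f,
      (forall mu g, dirichlet_eigen a V mu g -> mu <= lam),
      (forall x, 0 <= f x) &
      \sum_(x <- box d a) f x ^+ 2 = 1].

Definition l2box {R : realType} (d : nat) (a : R) (f : Zpt d -> R) : R :=
  Num.sqrt (\sum_(x <- box d a) f x ^+ 2).

Definition centred_gaussian_law {R : realType} (s2 : R) (A : set R) : \bar R :=
  if s2 == 0 then ((\1_A : R -> R) 0)%:E else normal_prob 0 (Num.sqrt s2) A.

(* xi is a centred Gaussian field on Z^d with covariance E[xi x xi y] = v (x - y):
   every finite linear combination sum c_k xi(x_k) is N(0, sum c_k c_l v(x_k - x_l)). *)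
Definition gaussian_field {R : realType} {dT : measure_display}
    {T : measurableType dT} (P : probability T R) (d : nat)
    (xi : Zpt d -> T -> R) (v : Zpt d -> R) : Prop :=
  (forall x, measurable_fun setT (xi x)) /\
  (forall (s : seq (Zpt d * R)) (A : set R), measurable A ->
     P ((fun w => \sum_(p <- s) p.2 * xi p.1 w) @^-1` A) =
     centred_gaussian_law (\sum_(p <- s) \sum_(q <- s) p.2 * q.2 * v (p.1 - q.1)) A).

Definition negl {R : realType} (u w : nat -> R) : Prop :=
  (\forall L \near \oo, w L != 0) /\ ((fun L => u L / w L) @ \oo --> 0).

Definition zeta {R : realType} {T : Type} (d : nat) (xi : Zpt d -> T -> R)
    (v : Zpt d -> R) (x0 x : Zpt d) (w : T) : R :=
  xi x w - xi x0 w * v (x - x0).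

Definition Phi {R : realType} {T : Type} (d : nat) (xi : Zpt d -> T -> R)
    (v : Zpt d -> R) (r : R) (phibar : Zpt d -> R) (y : Zpt d) (w : T) : R :=
  \sum_(x <- box d r | x != 0) phibar x ^+ 2 * zeta xi v y (x + y) w.

Definition Xi {R : realType} {T : Type} (d : nat) (xi : Zpt d -> T -> R)
    (v : Zpt d -> R) (r : R) (phibar : Zpt d -> R) (y : Zpt d) (w : T) : R :=
  xi y w + Phi xi v r phibar y w.

(* The event E_{L,x0}(kappa) (for fixed L), with theta = 2d+1, S(x) = a(1 - v(x)). *)
Definition Eevent {R : realType} {dT : measure_display} {T : measurableType dT}
    (P : probability T R) (d : nat) (xi : Zpt d -> T -> R) (v : Zpt d -> R)
    (a dd RR kappa : R) (x0 : Zpt d) (w : T) : Prop :=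
  [/\ `|xi x0 w - a| < (2 * d + 1)%:R,
      (forall x, inbox (2 * RR) (x - x0) ->
         `|zeta xi v x0 x w| <= 10^-1 * (a * (1 - v (x - x0)))) &
      (forall x, inbox RR (x - x0) -> x != x0 ->
         `|zeta xi v x0 x w| / Num.sqrt (fine ('V_P[zeta xi v x0 x])%E)
           <= (a / dd) `^ (kappa * enorm (x - x0)) *
              Num.sqrt (Num.max 1 (`|xi x0 w - a| * a)))].

(* Main.v *)
(** Write [xi = xi(x0) v(. - x0) + zeta].  On the event, [xi] has an isolated peak
at [x0], of height [m ~ a_L / d_L] above the rest of the box, and so has [- S] at the
origin.  A ground state [f] of a potential with such a peak satisfies
[m f <= sum of f over the neighbours] off the peak, hence decays like
[(2 d / m) ^ |x|_1].

Let [psi] be [phibar] translated to [x0], [H = Delta + xi] and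
[sigma = (H - lam) psi].  Subtracting from [phi] the multiple [t psi] that agrees
with it at [x0] leaves a function [g] vanishing at [x0]; on such functions
[lam - H] is at least [m - 2 d], because [Delta <= 0].  As
[(lam - H) g = t sigma] and [<sigma, phi> = 0], this gives both
[|g| <= t |sigma| / (m - 2 d)] and the quadratic error
[0 <= lam - <H psi, psi> <= |sigma|^2 / (m - 2 d)].

The Rayleigh quotient [<H psi, psi>] is [lbar + Xi(x0)] up to [O(d_L / a_L^2)], and
[|sigma|^2] is controlled by the residual of [psi], which is estimated from the
decay of [phibar], the variance of [zeta], and the fact that the box of side
[r_L >= a_L] truncates only mass [O(1 / a_L)]. *)

Require Import Defs.
From HB Require Import structures.
From mathcomp Require Import all_boot all_order all_algebra.
From mathcomp Require Import all_classical all_reals all_analysis.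
From mathcomp Require Import measurable_realfun.
From mathcomp Require Import ring lra zify.
Import Order.TTheory GRing.Theory Num.Theory numFieldNormedType.Exports.
Local Open Scope ring_scope.
Local Open Scope classical_set_scope.

Set Implicit Arguments.
Unset Strict Implicit.
Unset Printing Implicit Defensive.

(* Both sides of the inequality vanish at [t = 1], so their slopes there agree. *)
Lemma slope_at1_eq {R : realFieldType} (S M : R) : 0 < S -> 0 <= M ->
  (forall t, 0 < t -> (1 - t ^- 2) / (2 * S) * M <= t - 1) -> M = S.
Proof.
move=> S0 M0 bound; apply/eqP; rewrite -subr_eq0 -normr_le0.
apply/ler_addgt0Pr => e e0; rewrite add0r.
have M_le (t : R) : 0 < t -> (t ^+ 2 - 1) * M <= 2 * S * t ^+ 2 * (t - 1).
  move=> t0; have c0 : 0 < 2 * S * t ^+ 2 by rewrite !mulr_gt0// exprn_gt0.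
  have -> : (t ^+ 2 - 1) * M = 2 * S * t ^+ 2 * ((1 - t ^- 2) / (2 * S) * M).
    by field; rewrite !gt_eqF.
  by rewrite ler_pM2l//; exact: bound.
have [h [h0 h_half h_e]] : exists h : R, [/\ 0 < h, h <= 2^-1 & 3 * S * h <= e].
  exists (Num.min 2^-1 (e / (3 * S))); split.
  - by rewrite lt_min invr_gt0 ltr0n divr_gt0// mulr_gt0.
  - by rewrite ge_min lexx.
  - by rewrite mulrC -ler_pdivlMr ?mulr_gt0// ge_min lexx orbT.
have above : (2 + h) * M <= 2 * S * (1 + h) ^+ 2.
  rewrite -(ler_pM2l h0); have := M_le (1 + h) ltac:(lra); lra.
have below : 2 * S * (1 - h) ^+ 2 <= (2 - h) * M.
  rewrite -(ler_pM2l h0); have := M_le (1 - h) ltac:(lra); lra.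
rewrite ler_norml; apply/andP; split; nra.
Qed.

Section normal_moments.
Context {R : realType}.
Local Notation mu := (@lebesgue_measure R).

Lemma ge0_integral_normal_prob (m s : R) (f : measurableTypeR R -> \bar R) :
  (forall x, 0 <= f x)%E -> measurable_fun [set: R] f ->
  (\int[normal_prob m s]_x f x = \int[mu]_x (f x * (normal_pdf m s x)%:E))%E.
Proof.
move=> f0 mf; have dom := normal_prob_dominates m s.
have mpdf : measurable_fun [set: R] (fun x => (normal_pdf m s x)%:E).
  by apply/measurable_EFinP; exact: measurable_normal_pdf.
have mdensity := Radon_Nikodym_SigmaFinite.f_integrable dom.
rewrite -(Radon_Nikodym_SigmaFinite.change_of_variables dom)//.
apply: ae_eq_integral => //.
- by apply: emeasurable_funM => //; exact: measurable_int mdensity.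
- exact: emeasurable_funM.
- apply: ae_eqe_mul2l => /=; apply: integral_ae_eq => //=.
  by move=> E _ mE; rewrite -Radon_Nikodym_SigmaFinite.f_integral.
Qed.

Variable s : R.
Hypothesis s0 : 0 < s.

(* [1 + u <= exp u] at [u = (1 - t^-2) x^2 / 2 s^2]. *)
Lemma normal_pdf_rescale_ge (t x : R) : 0 < t ->
  normal_pdf 0 s x + (1 - t ^- 2) / (2 * s ^+ 2) * (x ^+ 2 * normal_pdf 0 s x) <=
  t * normal_pdf 0 (t * s) x.
Proof.
move=> t0; have ts0 : 0 < t * s by exact: mulr_gt0.
have peakE : t * normal_peak (t * s) = normal_peak s.
  rewrite /normal_peak exprMn -mulrA -mulrnAr sqrtrM ?sqr_ge0// sqrtr_sqr.
  by rewrite (gtr0_norm t0) invfM mulrA divff ?mul1r// gt_eqF.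
set u := (1 - t ^- 2) / (2 * s ^+ 2) * x ^+ 2.
rewrite mulrA -/u -[X in X + _]mul1r -mulrDl mulrC !normal_pdfE ?gt_eqF//.
rewrite [leRHS]mulrA peakE -mulrA ler_wpM2l ?normal_peak_ge0//.
have -> : normal_fun 0 (t * s) x = normal_fun 0 s x * expR u.
  by rewrite /normal_fun subr0 -expRD; congr expR; rewrite /u; field; rewrite !gt_eqF.
by rewrite ler_wpM2l ?expR_ge0// expR_ge1Dx.
Qed.

Let sqr_pdf (x : R) : R := x ^+ 2 * normal_pdf 0 s x.

Let sqr_pdf_ge0 x : 0 <= sqr_pdf x.
Proof. by rewrite mulr_ge0 ?sqr_ge0 ?normal_pdf_ge0. Qed.

Let measurable_sqr_pdf : measurable_fun [set: R] sqr_pdf.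
Proof. by apply: measurable_funM; [exact: measurable_funX|exact: measurable_normal_pdf]. Qed.

Lemma integrable_sqr_normal_pdf :
  mu.-integrable setT (fun x => (x ^+ 2 * normal_pdf 0 s x)%:E).
Proof.
pose k : R := 8 / 3 * s ^+ 2.
have pdfi := integrableZl measurableT (k * 2) (integrable_normal_pdf 0 (2 * s)).
apply: (le_integrable measurableT _ _ pdfi).
  by apply/measurable_EFinP; exact: measurable_sqr_pdf.
have k0 : 0 < k by rewrite mulr_gt0// exprn_gt0.
move=> x _; rewrite -EFinM !abse_EFin lee_fin !ger0_norm ?sqr_pdf_ge0//; last first.
  by rewrite mulr_ge0 ?normal_pdf_ge0// mulr_ge0 ?(ltW k0).
rewrite -(mulrA k) -ler_pdivrMl//; apply: le_trans (normal_pdf_rescale_ge x (t := 2) _) => //.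
have -> : (1 - 2 ^- 2) / (2 * s ^+ 2) = k^-1 by rewrite /k; field; rewrite gt_eqF.
by rewrite lerDr normal_pdf_ge0.
Qed.

Let M : R := (\int[mu]_x (sqr_pdf x))%R.

Let second_moment_rescale (t : R) : 0 < t -> (1 - t ^- 2) / (2 * s ^+ 2) * M <= t - 1.
Proof.
move=> t0; set k := _ / _.
have pdfi (u : R) := integrable_normal_pdf 0 u.
have sqri := integrable_sqr_normal_pdf.
have pdf_int (u c : R) : (\int[mu]_x (c * normal_pdf 0 u x) = c)%R.
  by rewrite (RintegralZl _ measurableT (pdfi u)) /Rintegral integral_normal_pdf mulr1.
have : \int[mu]_x (1 * normal_pdf 0 s x + k * sqr_pdf x) <=
    \int[mu]_x (t * normal_pdf 0 (t * s) x).
  apply: le_Rintegral => //.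
  - exact: (integrableD _ (integrableZl _ 1 (pdfi s)) (integrableZl _ k sqri)).
  - exact: (integrableZl measurableT t (pdfi _)).
  - by move=> x _; rewrite mul1r; exact: normal_pdf_rescale_ge.
rewrite (RintegralD _ (integrableZl _ 1 (pdfi s)) (integrableZl _ k sqri))//.
by rewrite (RintegralZl k measurableT sqri) !pdf_int -/M lerBrDl.
Qed.

Lemma normal_second_moment : (\int[normal_prob 0 s]_x (x ^+ 2)%:E = (s ^+ 2)%:E)%E.
Proof.
rewrite ge0_integral_normal_prob; last 2 first.
- by move=> x; rewrite lee_fin sqr_ge0.
- by apply/measurable_EFinP; exact: measurable_funX.
rewrite -[LHS](@fineK _ (\int[mu]_x (sqr_pdf x)%:E)%E); last first.
  exact: integrable_fin_num integrable_sqr_normal_pdf.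
congr EFin; apply: slope_at1_eq second_moment_rescale; first by rewrite exprn_gt0.
exact: Rintegral_ge0.
Qed.

End normal_moments.

Section gaussian_variance.
Context {R : realType} {dT : measure_display} {T : measurableType dT}.
Variable P : probability T R.
Implicit Types (X Y : T -> R) (A : set R).

Let real_RV X (mX : measurable_fun setT X) : {RV P >-> measurableTypeR R} :=
  @mfun_Sub _ _ T (measurableTypeR R) X (mem_set mX).

Lemma eq_law_expectation X Y : X \in Lfun P 1 -> Y \in Lfun P 1 ->
  (forall A, measurable A -> P (X @^-1` A) = P (Y @^-1` A)) -> ('E_P[X] = 'E_P[Y])%E.
Proof.
move=> X1 Y1 lawXY.
have law_expectation Z (mZ : measurable_fun setT Z) : Z \in Lfun P 1 ->
    ('E_P[Z] = \int[distribution P (real_RV mZ)]_y y%:E)%E.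
  have mE : measurable_fun setT (fun y : measurableTypeR R => y%:E) by exact/measurable_EFinP.
  by move=> /Lfun1_integrable iZ; rewrite unlock (integral_distribution mE).
have [mX mY] : measurable_fun setT X /\ measurable_fun setT Y.
  by split; apply/measurable_EFinP; [move: X1|move: Y1] => /Lfun1_integrable/measurable_int.
rewrite (law_expectation _ mX)// (law_expectation _ mY)//.
by apply: eq_measure_integral => A mA _; exact: lawXY.
Qed.

Lemma symmetric_law_expectation0 X : X \in Lfun P 1 ->
  (forall A, measurable A -> P (X @^-1` A) = P ((\- X) @^-1` A)) -> ('E_P[X] = 0)%E.
Proof.
move=> X1 lawX; have NX : (\- X) = -1 \o* X by apply/funext => w /=; rewrite mulrN1.
have NX1 : (\- X) \in Lfun P 1.
  by apply/Lfun1_integrable; move: X1 => /Lfun1_integrable/integrableN.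
have := eq_law_expectation X1 NX1 lawX; rewrite NX expectationZl//.
have : ('E_P[X])%E \is a fin_num by exact: expectation_fin_num.
by case: ('E_P[X])%E => // e _; rewrite -EFinM => -[] e0; congr EFin; lra.
Qed.

Variables (X : T -> R) (s2 : R).
Hypotheses (mX : measurable_fun setT X) (s20 : 0 < s2).
Hypothesis lawX : forall A, measurable A -> P (X @^-1` A) = centred_gaussian_law s2 A.

Lemma gaussian_second_moment : (\int[P]_w (X w ^+ 2)%:E = s2%:E)%E.
Proof.
have sqrt_s2 : 0 < Num.sqrt s2 by rewrite sqrtr_gt0.
rewrite -(sqr_sqrtr (ltW s20)) -(normal_second_moment sqrt_s2).
have msqr : measurable_fun setT (fun x : measurableTypeR R => (x ^+ 2)%:E).
  by apply/measurable_EFinP; exact: measurable_funX.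
have sqr0 (y : measurableTypeR R) : (0 <= (y ^+ 2)%:E)%E by rewrite lee_fin sqr_ge0.
rewrite -(ge0_integral_distribution (real_RV mX) msqr sqr0).
apply: (@eq_measure_integral _ (measurableTypeR R)) => A mA _.
by rewrite [LHS]lawX// /centred_gaussian_law gt_eqF.
Qed.

Lemma gaussian_Lfun2 : X \in Lfun P 2%:E.
Proof.
rewrite inE; apply/andP; split; rewrite inE//=.
rewrite /finite_norm unlock /Lnorm poweR_lty//.
under eq_integral => w _ do
  rewrite /= powR_mulrn// -normrX (ger0_norm (sqr_ge0 _)).
by rewrite gaussian_second_moment ltry.
Qed.

Lemma gaussian_variance :
  (forall A, measurable A -> P (X @^-1` A) = P ((\- X) @^-1` A)) -> ('V_P[X] = s2%:E)%E.
Proof.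
move=> symX; have X2 := gaussian_Lfun2.
have X1 := Lfun_subset12 (fin_num_measure P _ measurableT) X2.
rewrite varianceE// (symmetric_law_expectation0 X1 symX) expe2 mule0 sube0.
by rewrite unlock -gaussian_second_moment.
Qed.

End gaussian_variance.

Section square_sums.
Context {R : realDomainType} {T : Type}.
Implicit Types (s : seq T) (f g : T -> R).

Lemma sum_cauchy_schwarz s f g :
  (\sum_(x <- s) f x * g x) ^+ 2 <=
  (\sum_(x <- s) f x ^+ 2) * (\sum_(x <- s) g x ^+ 2).
Proof.
have : 0 <= \sum_(x <- s) \sum_(y <- s) (f x * g y - f y * g x) ^+ 2.
  by apply: sumr_ge0 => x _; apply: sumr_ge0 => y _; exact: sqr_ge0.
have -> : \sum_(x <- s) \sum_(y <- s) (f x * g y - f y * g x) ^+ 2 =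
    \sum_(x <- s) \sum_(y <- s) (f x ^+ 2 * g y ^+ 2) +
    \sum_(x <- s) \sum_(y <- s) (g x ^+ 2 * f y ^+ 2) -
    2 * \sum_(x <- s) \sum_(y <- s) ((f x * g x) * (f y * g y)).
  rewrite mulr_sumr -big_split/= -sumrB; apply: eq_bigr => x _.
  rewrite mulr_sumr -big_split/= -sumrB; apply: eq_bigr => y _; ring.
rewrite -!big_distrlr/= expr2; lra.
Qed.

Lemma sum_sqr_le_sqr_sum s f : (forall x, 0 <= f x) ->
  \sum_(x <- s) f x ^+ 2 <= (\sum_(x <- s) f x) ^+ 2.
Proof.
move=> f0; elim: s => [|x s IH]; first by rewrite !big_nil expr0n.
rewrite !big_cons; have S0 : 0 <= \sum_(y <- s) f y by exact: sumr_ge0.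
have := mulr_ge0 (f0 x) S0; lra.
Qed.

End square_sums.

Section supported_sums.
Context {R : realDomainType} {T : eqType}.
Implicit Types (s t : seq T) (h : T -> R).

Lemma eq_sum_supp s t h : uniq s -> uniq t ->
  (forall x, h x != 0 -> (x \in s) = (x \in t)) ->
  \sum_(x <- s) h x = \sum_(x <- t) h x.
Proof.
move=> us ut st; apply: perm_big_supp; apply: uniq_perm; rewrite ?filter_uniq// => x.
by rewrite !mem_filter; case: eqVneq => // /st.
Qed.

Lemma ler_sum_supp s t h : uniq s -> uniq t -> (forall x, 0 <= h x) ->
  (forall x, h x != 0 -> x \in s -> x \in t) ->
  \sum_(x <- s) h x <= \sum_(x <- t) h x.
Proof.
move=> us ut h0 st; rewrite (@eq_sum_supp s [seq x <- t | x \in s]) ?filter_uniq//.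
- by rewrite big_filter big_mkcond/=; apply: ler_sum => x _; case: ifP.
- by move=> x hx; rewrite mem_filter andb_idr//; exact: st.
Qed.

Lemma ler_term_sum s h x : uniq s -> (forall y, 0 <= h y) -> x \in s ->
  h x <= \sum_(y <- s) h y.
Proof.
move=> us h0 xs; rewrite -(big_seq1 +%R x h); apply: ler_sum_supp => // y _.
by rewrite inE => /eqP ->.
Qed.

End supported_sums.

Section l1norm.
Context {d : nat}.
Implicit Types (x y : Zpt d) (i : 'I_d).

Definition l1norm x : nat := \sum_(i < d) `|x i|%N.

Lemma l1norm0 : l1norm 0 = 0%N.
Proof. by rewrite /l1norm big1// => i _; rewrite ffunE. Qed.

Lemma l1norm_eq0 x : (l1norm x == 0%N) = (x == 0).
Proof.
apply/idP/eqP => [|->]; last by rewrite l1norm0.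
rewrite sum_nat_eq0 => /forallP x0; apply/ffunP => i; rewrite ffunE.
by have := x0 i; rewrite absz_eq0 => /eqP.
Qed.

Lemma l1norm_gt0 x : (0 < l1norm x)%N = (x != 0).
Proof. by rewrite lt0n l1norm_eq0. Qed.

Lemma l1normN x : l1norm (- x) = l1norm x.
Proof. by apply: eq_bigr => i _; rewrite ffunE abszN. Qed.

Lemma l1norm_triangle x y : (l1norm (x + y)%R <= l1norm x + l1norm y)%N.
Proof.
rewrite -big_split; apply: leq_sum => i _ /=.
by rewrite ffunE; move: (x i) (y i) => u w; lia.
Qed.

Lemma l1norm_unitv i : l1norm (unitv i) = 1%N.
Proof.
rewrite /l1norm (bigD1 i)//= ffunE eqxx big1// => j ji.
by rewrite ffunE eq_sym (negbTE ji).
Qed.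

Lemma l1norm_eq1 x : l1norm x = 1%N -> exists i, x = unitv i \/ x = - unitv i.
Proof.
move=> x1; have [i xi] : exists i, x i != 0.
  by apply/existsP; rewrite -negb_forall; apply/negP => /forallP x0; move: x1;
    rewrite /l1norm big1// => i _; move/eqP: (x0 i) => ->.
move: x1; rewrite /l1norm (bigD1 i)//=; set rest := (\sum_(j | _) _)%N => x1.
have rest0 : rest = 0%N by move: (x i) xi x1 => z; lia.
have xj j : j != i -> x j = 0.
  by move: rest0 => /eqP; rewrite sum_nat_eq0 => /forallP/(_ j)/implyP h /h;
    rewrite absz_eq0 => /eqP.
exists i; have [xi1|xi1] : x i = 1 \/ x i = -1 by move: (x i) xi x1 => z; lia.
- by left; apply/ffunP => j; rewrite ffunE; case: eqVneq => [<-//|ij];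
    rewrite xj// eq_sym.
- by right; apply/ffunP => j; rewrite !ffunE; case: eqVneq => [<-//|ij];
    rewrite xj// eq_sym.
Qed.

End l1norm.

Section boxes.
Context {R : realType} {d : nat}.
Implicit Types (a b : R) (x y : Zpt d) (f g h : Zpt d -> R).

Lemma inboxP a x : reflect (forall i, `|(x i)%:~R : R| <= a / 2) (inbox a x).
Proof. exact: forallP. Qed.

Lemma inbox0 a : 0 <= a -> inbox a (0 : Zpt d).
Proof. by move=> a0; apply/inboxP => i; rewrite ffunE normr0 divr_ge0. Qed.

Lemma inboxN a x : inbox a (- x) = inbox a x.
Proof. by apply: eq_forallb => i; rewrite ffunE rmorphN normrN. Qed.

Lemma inboxD a b x y : inbox a x -> inbox b y -> inbox (a + b) (x + y).
Proof.
move=> /inboxP xa /inboxP yb; apply/inboxP => i; rewrite ffunE rmorphD/=.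
by rewrite mulrDl (le_trans (ler_normD _ _))// lerD.
Qed.

Lemma inbox_le a b x : a <= b -> inbox a x -> inbox b x.
Proof. by move=> ab /inboxP xa; apply/inboxP => i; rewrite (le_trans (xa i))// ler_pM2r. Qed.

Lemma cube_uniq N : uniq (cube d N).
Proof.
rewrite map_inj_uniq ?enum_uniq// => k k' /ffunP kk'.
apply/ffunP => i; apply/val_inj; have := kk' i; rewrite !ffunE /=; lia.
Qed.

Lemma mem_cube N x : (forall i, (`|x i| <= N)%N) -> x \in cube d N.
Proof.
move=> xN; apply/mapP.
exists [ffun i => inord (absz (x i + N%:Z))]; rewrite ?mem_enum//.
apply/ffunP => i; rewrite !ffunE; move: (x i) (xN i) => z zN.
by rewrite inordK; lia.
Qed.

Lemma mem_box a x : (x \in box d a) = inbox a x.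
Proof.
rewrite mem_filter andb_idr// => /inboxP xa; apply: mem_cube => i.
have floor0 : 0 <= Num.floor (`|a| / 2) by rewrite floor_ge0 divr_ge0.
rewrite -lez_nat (gez0_abs floor0) abszE floor_ge_int/= intr_norm.
apply: le_trans (xa i) _; rewrite ler_pM2r ?invr_gt0//; exact: ler_norm.
Qed.

Lemma box_uniq a : uniq (box d a).
Proof. by rewrite filter_uniq// cube_uniq. Qed.

Lemma enorm_le_l1norm x : enorm x <= (l1norm x)%:R :> R.
Proof.
rewrite -(@ler_pXn2r _ 2) ?nnegrE ?sqrtr_ge0// sqr_sqrtr; last first.
  by apply: sumr_ge0 => i _; exact: sqr_ge0.
rewrite /l1norm natr_sum (le_trans _ (sum_sqr_le_sqr_sum _ _))//.
by apply: ler_sum => i _; rewrite natr_absz intr_norm real_normK ?num_real.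
Qed.

Lemma notin_box_l1norm a x : ~~ inbox a x -> a / 2 <= (l1norm x)%:R.
Proof.
rewrite negb_forall => /existsP[i]; rewrite -ltNge => /ltW/le_trans; apply.
by rewrite -intr_norm -natr_absz ler_nat /l1norm (bigD1 i)//= leq_addr.
Qed.

Definition box_supported a f : Prop := forall x, ~~ inbox a x -> f x = 0.

Lemma box_supported_neq0 a f x : box_supported a f -> f x != 0 -> inbox a x.
Proof. by move=> fa; apply: contraNT => /fa ->. Qed.

Lemma sum_box_translate a b y h : box_supported b h ->
  (forall x, h x != 0 -> inbox a (x + y)) ->
  \sum_(x <- box d a) h (x - y) = \sum_(x <- box d b) h x.
Proof.
move=> hb ha; rewrite -(big_map (fun x => x - y) predT h).
apply: eq_sum_supp; rewrite ?box_uniq ?map_inj_uniq ?box_uniq//; first exact: addIr.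
move=> x hx; rewrite [RHS]mem_box (box_supported_neq0 hb hx); apply/mapP.
by exists (x + y); rewrite ?addrK// mem_box ha.
Qed.

Lemma sum_box_translate_le a b y h : box_supported b h -> (forall x, 0 <= h x) ->
  \sum_(x <- box d a) h (x - y) <= \sum_(x <- box d b) h x.
Proof.
move=> hb h0; rewrite -(big_map (fun x => x - y) predT h).
apply: ler_sum_supp; rewrite ?map_inj_uniq ?box_uniq//; first exact: addIr.
by move=> x hx _; rewrite mem_box (box_supported_neq0 hb).
Qed.

End boxes.

Section geometric_sums.
Context {R : realType} {d : nat}.
Implicit Types (a p : R) (x : Zpt d).

Lemma sum_half_pow N :
  \sum_(j < N.*2.+1) (2^-1 : R) ^+ `|j%:Z - N%:Z|%N = 3 - 2 * 2^-1 ^+ N.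
Proof.
elim: N => [|N IH]; first by rewrite big_ord1 !expr0; lra.
rewrite doubleS big_ord_recl big_ord_recr/=.
transitivity (2^-1 ^+ N.+1 +
    (\sum_(j < N.*2.+1) (2^-1 : R) ^+ `|j%:Z - N%:Z|%N + 2^-1 ^+ N.+1)).
  congr (_ + (_ + _)).
  - by congr (_ ^+ _); lia.
  - by apply: eq_bigr => j _; congr (_ ^+ _); rewrite /bump /=; lia.
  - by congr (_ ^+ _); rewrite /bump /=; lia.
rewrite IH exprS; lra.
Qed.

Lemma sum_box_half_pow_le a : \sum_(x <- box d a) (2^-1 : R) ^+ l1norm x <= 3 ^+ d.
Proof.
set N := `|Num.floor (`|a| / 2)|%N.
apply: (@le_trans _ _ (\sum_(x <- cube d N) (2^-1 : R) ^+ l1norm x)).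
  rewrite /box big_filter big_mkcond/=; apply: ler_sum => x _.
  by case: ifP => // _; rewrite exprn_ge0.
rewrite /cube big_map big_enum/=.
under eq_bigr => k _.
  rewrite /l1norm -prodrXr.
  under eq_bigr => i _ do rewrite ffunE.
  over.
rewrite -(bigA_distr_bigA (fun (_ : 'I_d) (j : 'I_(N.*2.+1)) =>
  (2^-1 : R) ^+ `|j%:Z - N%:Z|%N)).
rewrite -[X in _ ^+ X]card_ord -prodr_const; apply: ler_prod => i _.
have half_pow_ge0 : 0 <= (2^-1 : R) ^+ N by rewrite exprn_ge0.
have half_pow_le1 : (2^-1 : R) ^+ N <= 1 by rewrite exprn_ile1//; lra.
by rewrite sum_half_pow; apply/andP; split; lra.
Qed.

Lemma sum_box_decay_le a p (c : R) (f : Zpt d -> R) : 0 <= c -> 0 <= p <= 2^-1 ->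
  (forall x, inbox a x -> x != 0 -> f x <= c * p ^+ l1norm x) ->
  \sum_(x <- box d a | x != 0) f x <= c * (2 * 3 ^+ d * p).
Proof.
move=> c0 /andP[p0 p2] fle.
apply: (@le_trans _ _ (\sum_(x <- box d a) c * (2 * p * 2^-1 ^+ l1norm x))).
  rewrite big_mkcond/= !big_seq; apply: ler_sum => x; rewrite mem_box => xa.
  case: ifPn => [x0|_]; last by rewrite !mulr_ge0 ?exprn_ge0.
  apply: le_trans (fle x xa x0) _; apply: ler_wpM2l => //.
  move: x0; rewrite -l1norm_gt0; case: (l1norm x) => // n _.
  rewrite !exprS (_ : 2 * p * (2^-1 * 2^-1 ^+ n) = p * 2^-1 ^+ n); last by field.
  by apply: ler_wpM2l => //; apply: lerXn2r; rewrite ?nnegrE.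
rewrite -!mulr_sumr; apply: ler_wpM2l => //; rewrite [leRHS]mulrAC.
by apply: ler_wpM2l; [rewrite mulr_ge0|exact: sum_box_half_pow_le].
Qed.

End geometric_sums.

Section lattice_laplacian.
Context {R : realType} {d : nat}.
Implicit Types (a t : R) (x y z : Zpt d) (f g h : Zpt d -> R).
Local Notation deg := (2 * d%:R).

Definition l2dot a f g : R := \sum_(x <- box d a) f x * g x.

Definition l2sq a f : R := \sum_(x <- box d a) f x ^+ 2.

Lemma l2sq_ge0 a f : 0 <= l2sq a f.
Proof. by apply: sumr_ge0 => x _; exact: sqr_ge0. Qed.

Lemma l2dotxx a f : l2dot a f f = l2sq a f.
Proof. by []. Qed.

Lemma l2dot_cauchy_schwarz a f g : l2dot a f g ^+ 2 <= l2sq a f * l2sq a g.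
Proof. exact: sum_cauchy_schwarz. Qed.

Lemma l2dotBZ a f g h t : l2dot a f (fun x => g x - t * h x) = l2dot a f g - t * l2dot a f h.
Proof. by rewrite /l2dot mulr_sumr -sumrB; apply: eq_bigr => x _; ring. Qed.

Definition nbsum f x : R := \sum_(i < d) (f (x + unitv i) + f (x - unitv i)).

Lemma lapE f x : lap f x = nbsum f x - deg * f x.
Proof.
rewrite /lap /nbsum (_ : deg * f x = \sum_(i < d) (f x + f x)); last first.
  by rewrite sumr_const card_ord -[in RHS]mulr_natr; ring.
by rewrite -sumrB; apply: eq_bigr => i _; ring.
Qed.

Lemma nbsum_ge0 f x : (forall y, 0 <= f y) -> 0 <= nbsum f x.
Proof. by move=> f0; apply: sumr_ge0 => i _; rewrite addr_ge0. Qed.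

Lemma nbsum_cst t x : nbsum (fun=> t) x = deg * t.
Proof. by rewrite /nbsum sumr_const card_ord -mulr_natr; ring. Qed.

Lemma nbsumZ t f x : nbsum (fun y => t * f y) x = t * nbsum f x.
Proof. by rewrite /nbsum mulr_sumr; apply: eq_bigr => i _; rewrite mulrDr. Qed.

Lemma nbsumB f g x : nbsum (fun y => f y - g y) x = nbsum f x - nbsum g x.
Proof. by rewrite /nbsum -sumrB; apply: eq_bigr => i _; ring. Qed.

Lemma nbsum_translate f x y : nbsum (fun z => f (z - y)) x = nbsum f (x - y).
Proof. by rewrite /nbsum; apply: eq_bigr => i _; rewrite !(addrAC x _ (- y)). Qed.

Lemma ler_nbsum f g x : (forall y, l1norm (y - x) = 1%N -> f y <= g y) ->
  nbsum f x <= nbsum g x.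
Proof.
move=> fg; apply: ler_sum => i _; apply: lerD; apply: fg.
  by rewrite addrAC subrr add0r l1norm_unitv.
by rewrite addrAC subrr add0r l1normN l1norm_unitv.
Qed.

Lemma ler_neighbour_nbsum f x y : (forall z, 0 <= f z) -> l1norm (y - x) = 1%N ->
  f y <= nbsum f x.
Proof.
move=> f0 /l1norm_eq1[i yx].
have rest0 : 0 <= \sum_(j < d | j != i) (f (x + unitv j) + f (x - unitv j)).
  by apply: sumr_ge0 => j _; rewrite addr_ge0.
have := f0 (x + unitv i); have := f0 (x - unitv i); rewrite /nbsum (bigD1 i)//=.
by case: yx => /(canRL (subrK x)) ->; rewrite (addrC _ x); lra.
Qed.

Lemma sqr_nbsum_le f x : nbsum f x ^+ 2 <= deg * nbsum (fun y => f y ^+ 2) x.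
Proof.
have := sum_cauchy_schwarz (index_enum 'I_d)
  (fun i => f (x + unitv i) + f (x - unitv i)) (fun=> 1).
under eq_bigr do rewrite mulr1.
under [X in _ <= _ * X]eq_bigr do rewrite expr1n.
rewrite sumr_const card_ord => /le_trans; apply.
rewrite mulrC -mulrA mulrCA ler_wpM2l// /nbsum mulr_sumr; apply: ler_sum => i _.
by have := sqr_ge0 (f (x + unitv i) - f (x - unitv i)); lra.
Qed.

Section supported.
Variable a : R.

Lemma sum_nbsum_le h : box_supported a h -> (forall x, 0 <= h x) ->
  \sum_(x <- box d a) nbsum h x <= deg * \sum_(x <- box d a) h x.
Proof.
move=> ha h0; rewrite -[leRHS](nbsum_cst _ 0) /nbsum exchange_big/=.
apply: ler_sum => i _; rewrite big_split/=; apply: lerD.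
  under eq_bigr do rewrite -[unitv i]opprK.
  exact: sum_box_translate_le.
exact: sum_box_translate_le.
Qed.

Lemma sum_nbsum_sqr_le f : box_supported a f ->
  \sum_(x <- box d a) nbsum (fun y => f y ^+ 2) x <= deg * l2sq a f.
Proof.
by move=> fa; apply: sum_nbsum_le => x; [move=> /fa ->; rewrite expr0n|exact: sqr_ge0].
Qed.

Lemma l2sq_nbsum_le f : box_supported a f -> l2sq a (nbsum f) <= deg ^+ 2 * l2sq a f.
Proof.
move=> fa; rewrite expr2 -mulrA.
apply: (@le_trans _ _ (deg * \sum_(x <- box d a) nbsum (fun y => f y ^+ 2) x)).
  by rewrite mulr_sumr; apply: ler_sum => x _; exact: sqr_nbsum_le.
by apply: ler_wpM2l; [rewrite mulr_ge0|exact: sum_nbsum_sqr_le].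
Qed.

Lemma l2dot_nbsum_le f : box_supported a f -> l2dot a f (nbsum f) <= deg * l2sq a f.
Proof.
move=> fa; have nbsum_le := sum_nbsum_sqr_le fa.
have young x : f x * nbsum f x <=
    2^-1 * (deg * f x ^+ 2) + 2^-1 * nbsum (fun y => f y ^+ 2) x.
  rewrite -(nbsum_cst _ x) /nbsum !mulr_sumr -big_split/=; apply: ler_sum => i _.
  have := sqr_ge0 (f x - f (x + unitv i)); have := sqr_ge0 (f x - f (x - unitv i)); lra.
apply: (@le_trans _ _ (\sum_(x <- box d a)
    (2^-1 * (deg * f x ^+ 2) + 2^-1 * nbsum (fun y => f y ^+ 2) x))).
  by apply: ler_sum => x _; exact: young.
rewrite big_split/= -!mulr_sumr -/(l2sq a f); lra.
Qed.

Lemma l2dot_nbsum_sym f g : box_supported a f -> box_supported a g ->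
  l2dot a f (nbsum g) = l2dot a (nbsum f) g.
Proof.
move=> fa ga.
have shift y : \sum_(x <- box d a) f x * g (x + y) =
    \sum_(x <- box d a) f (x - y) * g x.
  rewrite -(@sum_box_translate _ _ a a y (fun x => f x * g (x + y))).
  - by apply: eq_bigr => x _; rewrite subrK.
  - by move=> x /fa ->; rewrite mul0r.
  - by move=> x; rewrite mulf_eq0 negb_or => /andP[_]; exact: box_supported_neq0.
have shiftN y : \sum_(x <- box d a) f x * g (x - y) =
    \sum_(x <- box d a) f (x + y) * g x.
  by rewrite shift; apply: eq_bigr => x _; rewrite opprK.
rewrite /l2dot /nbsum; under eq_bigr do rewrite mulr_sumr.
under [RHS]eq_bigr do rewrite mulr_suml.
rewrite exchange_big [RHS]exchange_big/=; apply: eq_bigr => i _.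
under eq_bigr do rewrite mulrDr.
under [RHS]eq_bigr do rewrite mulrDl.
by rewrite !big_split/= shift shiftN addrC.
Qed.

End supported.

(* Any neighbour [y] of [x] satisfies [r / 2 <= |y|_1 + 1]. *)
Lemma nbsum_notin_box_le (r : R) f x : 0 < r -> ~~ inbox r x ->
  nbsum f x ^+ 2 <= deg * (2 / r * nbsum (fun y => (l1norm y).+1%:R * f y ^+ 2) x).
Proof.
move=> r0 xr; apply: le_trans (sqr_nbsum_le _ _) _.
apply: ler_wpM2l; first by rewrite mulr_ge0.
rewrite -nbsumZ; apply: ler_nbsum => y yx.
have x_le : (l1norm x)%:R <= (l1norm y).+1%:R :> R.
  rewrite ler_nat -addn1 -yx -(l1normN (y - x)) opprB -{1}(subrK y x) addrC.
  exact: l1norm_triangle.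
rewrite mulrA ler_peMl ?sqr_ge0// mulrAC ler_pdivlMr// mul1r.
by have := notin_box_l1norm xr; lra.
Qed.

Lemma neighbour_toward a x0 x : inbox a x0 -> inbox a x -> x != x0 ->
  exists z, [/\ inbox a z, l1norm (x - z) = 1%N &
    (l1norm (z - x0)%R < l1norm (x - x0)%R)%N].
Proof.
move=> /inboxP x0a /inboxP xa xx0.
have [i xi] : exists i, x i != x0 i.
  apply/existsP; rewrite -negb_forall; apply: contra xx0 => /forallP e.
  by apply/eqP/ffunP => i; exact/eqP.
pose s := sgz (x i - x0 i); pose z : Zpt d := [ffun j => if j == i then x i - s else x j].
have zi : z i = x i - s by rewrite ffunE eqxx.
have zj j : j != i -> z j = x j by rewrite ffunE => /negbTE ->.
exists z; split.
- apply/inboxP => j; have [->|ji] := eqVneq j i; last by rewrite zj.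
  rewrite zi -intr_norm; apply: (@le_trans _ _ (Num.max `|x0 i| `|x i|)%:~R).
    by rewrite ler_int /s; move: (x0 i) (x i) xi => u w; lia.
  by rewrite /Num.max; case: ifP => _; rewrite intr_norm.
- rewrite /l1norm (bigD1 i)//= !ffunE eqxx big1 => [|j ji].
    by rewrite /s; move: (x0 i) (x i) xi => u w; lia.
  by rewrite !ffunE (negbTE ji) subrr.
- rewrite /l1norm (bigD1 i)//= [ltnRHS](bigD1 i)//= -addSn leq_add//.
    by rewrite !ffunE eqxx /s; move: (x0 i) (x i) xi => u w; lia.
  by apply: leq_sum => j ji; rewrite !ffunE (negbTE ji).
Qed.

End lattice_laplacian.

Section ground_states.
Context {R : realType} {d : nat}.
Implicit Types (a lam m : R) (V f : Zpt d -> R) (x : Zpt d).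
Local Notation deg := (2 * d%:R).

Definition ground_state a V lam f : Prop :=
  [/\ dirichlet_eigen a V lam f, (forall x, 0 <= f x) & l2sq a f = 1].

Lemma principal_ground_state a V lam f :
  principal_eigenpair a V lam f -> ground_state a V lam f.
Proof. by case. Qed.

Definition isolated_peak a V x0 m : Prop :=
  inbox a x0 /\ forall x, inbox a x -> x != x0 -> V x + m <= V x0.

Lemma l2sq_le1 a f x : l2sq a f = 1 -> inbox a x -> f x ^+ 2 <= 1.
Proof.
move=> <- xa; apply: (@ler_term_sum _ _ _ (fun y => f y ^+ 2)); rewrite ?box_uniq ?mem_box//.
by move=> y; exact: sqr_ge0.
Qed.

Lemma dirichlet_nbsum a V lam f x : dirichlet_eigen a V lam f -> inbox a x ->
  nbsum f x = (lam + deg - V x) * f x.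
Proof. by move=> [_ _ eq] /eq; rewrite lapE; lra. Qed.

Section ground_state.
Variables (a lam m : R) (V f : Zpt d -> R) (x0 : Zpt d).
Hypotheses (gsf : ground_state a V lam f) (peakV : isolated_peak a V x0 m).

Lemma ground_state_gt0 x : inbox a x -> 0 < f x.
Proof.
have [eig f0 _] := gsf; move=> xa; rewrite lt_neqAle f0 andbT; apply/negP => /eqP fx0.
(* Zeros propagate to all the neighbours, by the eigenvalue equation. *)
have zero_near k y : inbox a y -> (l1norm (y - x)%R <= k)%N -> f y = 0.
  elim: k y => [|k IH] y ya.
    by rewrite leqn0 l1norm_eq0 subr_eq0 => /eqP ->.
  move=> yk; have [->//|yx] := eqVneq y x.
  have [z [za zy zx]] := neighbour_toward xa ya yx.
  apply/eqP; rewrite eq_le f0 andbT (le_trans (ler_neighbour_nbsum f0 zy))//.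
  by rewrite (dirichlet_nbsum eig za) IH ?mulr0// -ltnS (leq_trans zx).
have [out [y /eqP fy] _] := eig; apply: fy.
by have [ya|/out//] := boolP (inbox a y); exact: zero_near (leqnn _).
Qed.

Lemma ground_state_eigenvalue_ge x : inbox a x -> V x - deg <= lam.
Proof.
move=> xa; have [eig f0 _] := gsf; have fx0 := ground_state_gt0 xa.
by have := nbsum_ge0 x f0; rewrite (dirichlet_nbsum eig xa) pmulr_lge0//; lra.
Qed.

Lemma ground_state_off_peak_le x : x != x0 -> m * f x <= nbsum f x.
Proof.
have [eig f0 _] := gsf; have [x0a Vm] := peakV.
move=> xx0; have [xa|xa] := boolP (inbox a x); last first.
  by have [-> //] := eig; rewrite mulr0 nbsum_ge0.
rewrite (dirichlet_nbsum eig xa) ler_wpM2r//.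
by have := ground_state_eigenvalue_ge x0a; have := Vm _ xa xx0; lra.
Qed.

Lemma ground_state_concentration : 0 <= m -> m ^+ 2 * (1 - f x0 ^+ 2) <= deg ^+ 2.
Proof.
have [eig f0 f1] := gsf; have [x0a _] := peakV; have [fa _ _] := eig.
move=> m0; have : l2sq a (nbsum f) <= deg ^+ 2.
  by have := l2sq_nbsum_le fa; rewrite f1 mulr1.
apply: le_trans; rewrite -f1 /l2sq (bigD1_seq x0)/= ?mem_box ?box_uniq//.
rewrite addrAC subrr add0r mulr_sumr big_mkcond/=.
apply: ler_sum => x _; case: ifPn => [xx0|_]; last exact: sqr_ge0.
rewrite -exprMn; apply: lerXn2r; rewrite ?nnegrE ?mulr_ge0 ?nbsum_ge0//.
exact: ground_state_off_peak_le.
Qed.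

Lemma ground_state_peak_ge : 0 < m -> 2 * deg <= m -> 2^-1 <= f x0 ^+ 2.
Proof.
move=> m0 degm; have m20 : 0 < m ^+ 2 by rewrite exprn_gt0.
have deg2 : (2 * deg) ^+ 2 <= m ^+ 2.
  by apply: lerXn2r => //; rewrite nnegrE ?(ltW m0)// !mulr_ge0.
suff : m ^+ 2 * 2^-1 <= m ^+ 2 * f x0 ^+ 2 by rewrite ler_pM2l.
have := ground_state_concentration (ltW m0); move: deg2; rewrite (exprMn 2); lra.
Qed.

Lemma ground_state_decay : 0 < m -> forall x, f x <= (deg / m) ^+ l1norm (x - x0).
Proof.
have [[fa _ _] f0 f1] := gsf; move=> m0 x.
suff decay k y : (k <= l1norm (y - x0)%R)%N -> f y <= (deg / m) ^+ k by exact: decay.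
elim: k y => [|k IH] y ky.
  have [ya|/fa ->//] := boolP (inbox a y).
  by rewrite expr0 -(@ler_pXn2r _ 2) ?nnegrE// expr1n (l2sq_le1 f1).
have yx0 : y != x0 by rewrite -subr_eq0 -l1norm_gt0 (leq_trans _ ky).
rewrite exprS mulrAC ler_pdivlMr// mulrC (le_trans (ground_state_off_peak_le yx0))//.
rewrite -[leRHS](nbsum_cst _ y); apply: ler_nbsum => z zy; apply: IH.
have := l1norm_triangle (y - z) (z - x0); rewrite addrA subrK -(l1normN (y - z)) opprB zy.
by rewrite -ltnS => /(leq_trans ky); rewrite add1n ltnS.
Qed.

End ground_state.

Lemma ground_state_weighted_sum_le r V lam f m (w : Zpt d -> R) (c p : R) :
  ground_state r V lam f -> isolated_peak r V 0 m -> 0 < m ->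
  0 <= c -> 0 <= p -> p * (deg / m) ^+ 2 <= 2^-1 -> w 0 = 0 ->
  (forall y, inbox r y -> y != 0 -> w y <= c * p ^+ l1norm y) ->
  \sum_(y <- box d r) w y * f y ^+ 2 <= c * (2 * 3 ^+ d * (p * (deg / m) ^+ 2)).
Proof.
move=> gsf peakV m0 c0 p0 pq w0 wle; have [_ f0 _] := gsf; have [zero_in _] := peakV.
rewrite (bigD1_seq 0) ?box_uniq ?mem_box//= w0 mul0r add0r.
apply: sum_box_decay_le => //; first by rewrite pq mulr_ge0// sqr_ge0.
move=> y yr y0; rewrite (exprMn (l1norm y) p) [leRHS]mulrA.
have := ground_state_decay gsf peakV m0 y; rewrite subr0 => fy.
apply: (@le_trans _ _ (c * p ^+ l1norm y * f y ^+ 2)).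
  by apply: ler_wpM2r; [exact: sqr_ge0|exact: wle].
apply: ler_wpM2l; first by rewrite mulr_ge0// exprn_ge0.
rewrite exprAC; apply: lerXn2r; rewrite ?nnegrE//.
by rewrite exprn_ge0// divr_ge0 ?mulr_ge0// ltW.
Qed.

End ground_states.

Section schrodinger.
Context {R : realType} {d : nat}.
Implicit Types (a lam m : R) (V f g : Zpt d -> R) (x : Zpt d).
Local Notation deg := (2 * d%:R).

Definition schrodinger V f x : R := lap f x + V x * f x.

Definition residual V lam f x : R := schrodinger V f x - lam * f x.

Lemma schrodingerE V f x : schrodinger V f x = nbsum f x + (V x - deg) * f x.
Proof. by rewrite /schrodinger lapE; ring. Qed.

Lemma schrodingerB V f g t x :
  schrodinger V (fun y => f y - t * g y) x = schrodinger V f x - t * schrodinger V g x.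
Proof. by rewrite !schrodingerE nbsumB nbsumZ; ring. Qed.

Lemma l2dot_schrodinger_sym a V f g : box_supported a f -> box_supported a g ->
  l2dot a f (schrodinger V g) = l2dot a (schrodinger V f) g.
Proof.
move=> fa ga.
transitivity (l2dot a f (nbsum g) + \sum_(x <- box d a) (V x - deg) * (f x * g x)).
  by rewrite -big_split; apply: eq_bigr => x _; rewrite schrodingerE/=; ring.
rewrite l2dot_nbsum_sym// -big_split; apply: eq_bigr => x _.
by rewrite schrodingerE/=; ring.
Qed.

Lemma l2dot_residual a V lam f g :
  l2dot a (residual V lam f) g = l2dot a (schrodinger V f) g - lam * l2dot a f g.
Proof.
by rewrite /l2dot mulr_sumr -sumrB; apply: eq_bigr => x _; rewrite /residual; ring.
Qed.

Lemma l2dot_residual_eigen a V lam phi f : dirichlet_eigen a V lam phi ->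
  box_supported a f -> l2dot a (residual V lam f) phi = 0.
Proof.
move=> [phia _ eig] fa; rewrite l2dot_residual -l2dot_schrodinger_sym//.
rewrite /l2dot mulr_sumr -sumrB !big_seq big1// => x.
by rewrite mem_box /schrodinger => /eig ->; ring.
Qed.

(* The lattice Laplacian is non-positive, so only the potential matters. *)
Lemma l2dot_schrodinger_gap a V x0 m g : isolated_peak a V x0 m ->
  box_supported a g -> g x0 = 0 ->
  l2dot a g (schrodinger V g) <= (V x0 - m) * l2sq a g.
Proof.
move=> [_ Vm] ga gx0.
have potential_le : \sum_(x <- box d a) V x * g x ^+ 2 <= (V x0 - m) * l2sq a g.
  rewrite mulr_sumr !big_seq; apply: ler_sum => x; rewrite mem_box => xa.
  have [->|xx0] := eqVneq x x0; first by rewrite gx0 expr0n !mulr0.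
  by apply: ler_wpM2r; [exact: sqr_ge0|rewrite lerBrDr Vm].
apply: le_trans potential_le.
have -> : l2dot a g (schrodinger V g) =
    l2dot a g (nbsum g) - deg * l2sq a g + \sum_(x <- box d a) V x * g x ^+ 2.
  rewrite /l2dot mulr_sumr -sumrB -big_split/=; apply: eq_bigr => x _.
  by rewrite schrodingerE; ring.
by rewrite gerDr subr_le0 l2dot_nbsum_le.
Qed.

End schrodinger.

Section perturbation.
Context {R : realType} {d : nat}.
Variables (a m lam : R) (V phi psi : Zpt d -> R) (x0 : Zpt d).
Local Notation deg := (2 * d%:R).
Hypotheses (m0 : 0 < m) (degm : 2 * deg <= m) (peakV : isolated_peak a V x0 m).
Hypothesis gs_phi : ground_state a V lam phi.
Hypotheses (psi0 : forall x, 0 <= psi x) (psia : box_supported a psi).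
Hypotheses (psi1 : l2sq a psi = 1) (psi_peak : 2^-1 <= psi x0 ^+ 2).

Let sigma := residual V lam psi.
Let overlap := l2dot a psi phi.
Let t := phi x0 / psi x0.
Let g x := phi x - t * psi x.

Let x0a : inbox a x0. Proof. by case: peakV. Qed.

Let phia : box_supported a phi. Proof. by case: gs_phi => -[]. Qed.

Let phi1 : l2sq a phi = 1. Proof. by case: gs_phi. Qed.

Let phi_peak : 2^-1 <= phi x0 ^+ 2.
Proof. exact: ground_state_peak_ge gs_phi peakV _ _. Qed.

Let psix0 : 0 < psi x0.
Proof.
rewrite lt_neqAle psi0 andbT eq_sym; apply/eqP => psi_eq0.
by move: psi_peak; rewrite psi_eq0 expr0n/=; lra.
Qed.

Let t0 : 0 < t. Proof. by rewrite divr_gt0// (ground_state_gt0 gs_phi x0a). Qed.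

Let t2 : t ^+ 2 <= 2.
Proof.
rewrite expr_div_n ler_pdivrMr ?exprn_gt0//.
by have := l2sq_le1 phi1 x0a; have := psi_peak; lra.
Qed.

Let overlap_ge : 2^-1 <= overlap.
Proof.
have [_ phi0 _] := gs_phi.
have overlap_peak : psi x0 * phi x0 <= overlap.
  apply: (@ler_term_sum _ _ _ (fun x => psi x * phi x)); rewrite ?box_uniq ?mem_box//.
  by move=> x; rewrite mulr_ge0.
apply: le_trans overlap_peak; rewrite -(@ler_pXn2r _ 2) ?nnegrE ?mulr_ge0// exprMn expr2.
by apply: ler_pM.
Qed.

Let ga : box_supported a g.
Proof. by move=> x xa; rewrite /g phia// psia// mulr0 subr0. Qed.

Let gx0 : g x0 = 0. Proof. by rewrite /g /t divfK ?subrr// gt_eqF. Qed.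

Let residual_g x : inbox a x -> lam * g x - schrodinger V g x = t * sigma x.
Proof.
have [[_ _ eig] _ _] := gs_phi.
by move=> /eig; rewrite schrodingerB /sigma /residual /g /schrodinger => ->; ring.
Qed.

Let gap_le : (m - deg) * l2sq a g <= t * l2dot a sigma g.
Proof.
have -> : t * l2dot a sigma g = lam * l2sq a g - l2dot a g (schrodinger V g).
  rewrite /l2dot !mulr_sumr -sumrB !big_seq; apply: eq_bigr => x; rewrite mem_box => xa.
  by rewrite mulrA -residual_g//; ring.
have := l2dot_schrodinger_gap peakV ga gx0.
have := ler_wpM2r (l2sq_ge0 a g) (ground_state_eigenvalue_ge gs_phi x0a); lra.
Qed.

Let rayleigh_defect : t * (lam - l2dot a (schrodinger V psi) psi) = l2dot a sigma g.
Proof.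
have [eig _ _] := gs_phi.
rewrite l2dotBZ (l2dot_residual_eigen eig psia) l2dot_residual l2dotxx psi1; ring.
Qed.

Let sigma_dot_le : (m - deg) * l2dot a sigma g <= t * l2sq a sigma.
Proof.
set X := l2dot a sigma g; have gap0 : 0 < m - deg by have := m0; have := degm; lra.
have X0 : 0 <= X.
  by rewrite -(pmulr_rge0 _ t0) (le_trans _ gap_le)// mulr_ge0 ?l2sq_ge0// ltW.
have [->|X_neq0] := eqVneq X 0; first by rewrite mulr0 mulr_ge0 ?l2sq_ge0 ?ltW.
have {X0 X_neq0}X_gt0 : 0 < X by rewrite lt_neqAle eq_sym X_neq0.
rewrite -(ler_pM2r X_gt0).
have := ler_wpM2l (ltW gap0) (l2dot_cauchy_schwarz a sigma g).
have := ler_wpM2r (l2sq_ge0 a sigma) gap_le; rewrite -/X; lra.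
Qed.

Lemma rayleigh_quotient_defect :
  m * `|lam - l2dot a (schrodinger V psi) psi| <= 2 * l2sq a sigma.
Proof.
have gap_ge : m / 2 <= m - deg by have := degm; lra.
rewrite -(ler_pM2l t0); set D := lam - _.
have D0 : 0 <= D.
  rewrite -(pmulr_rge0 _ t0) rayleigh_defect -(pmulr_rge0 _ t0) (le_trans _ gap_le)//.
  by rewrite mulr_ge0 ?l2sq_ge0//; have := m0; lra.
have := ler_wpM2r (mulr_ge0 (ltW t0) D0) gap_ge; rewrite (ger0_norm D0).
have := sigma_dot_le; rewrite -rayleigh_defect -/D; lra.
Qed.

(* [g] dominates the component of [phi] orthogonal to [psi], of squared norm [1 - overlap^2]. *)
Let l2sq_sub_le : l2sq a (fun x => phi x - psi x) <= 2 * l2sq a g.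
Proof.
have l2sq_subZ s : l2sq a (fun x => phi x - s * psi x) = 1 + s ^+ 2 - 2 * s * overlap.
  transitivity (l2sq a phi + s ^+ 2 * l2sq a psi - 2 * s * overlap); last first.
    by rewrite phi1 psi1 mulr1.
  by rewrite /overlap /l2dot /l2sq !mulr_sumr -big_split -sumrB/=; apply: eq_bigr => x _; ring.
have -> : l2sq a (fun x => phi x - psi x) = 2 - 2 * overlap.
  transitivity (l2sq a (fun x => phi x - 1 * psi x)); last by rewrite l2sq_subZ; ring.
  by apply: eq_bigr => x _; rewrite mul1r.
have overlap_le1 : overlap <= 1.
  have := l2dot_cauchy_schwarz a psi phi; rewrite psi1 phi1 -/overlap.
  by have := overlap_ge; nra.
have := sqr_ge0 (t - overlap); rewrite l2sq_subZ; have := overlap_ge; nra.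
Qed.

Lemma eigenvector_defect :
  m ^+ 2 * l2sq a (fun x => phi x - psi x) <= 16 * l2sq a sigma.
Proof.
have gap_ge : m / 2 <= m - deg by have := degm; lra.
have gap0 : 0 <= m - deg by have := m0; lra.
have g_le : (m - deg) ^+ 2 * l2sq a g <= t ^+ 2 * l2sq a sigma.
  have := ler_wpM2l gap0 gap_le; have := ler_wpM2l (ltW t0) sigma_dot_le; lra.
have m_le : (m / 2) ^+ 2 * l2sq a g <= (m - deg) ^+ 2 * l2sq a g.
  apply: ler_wpM2r; first exact: l2sq_ge0.
  by apply: lerXn2r; rewrite ?nnegrE//; have := m0; lra.
have := ler_wpM2r (l2sq_ge0 a sigma) t2.
have := ler_wpM2l (sqr_ge0 m) l2sq_sub_le; lra.
Qed.

Variable mu : R.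
Local Notation rho := (residual V mu psi).

Let l2sq_sigma_le : l2sq a sigma <= 10 * l2sq a rho.
Proof.
have [eig _ _] := gs_phi; pose del := lam - mu.
have rhoE x : rho x = sigma x + del * psi x by rewrite /sigma /residual /del; ring.
have del_overlap : del * overlap = l2dot a rho phi.
  rewrite -[LHS]add0r -(l2dot_residual_eigen eig psia) mulr_sumr -big_split/=.
  by apply: eq_bigr => x _; rewrite rhoE -/sigma; ring.
have del_le : del ^+ 2 <= 4 * l2sq a rho.
  have := l2dot_cauchy_schwarz a rho phi; rewrite -del_overlap phi1 mulr1 exprMn.
  have overlap2 : 4^-1 <= overlap ^+ 2 by have := overlap_ge; nra.
  by have := ler_wpM2l (sqr_ge0 del) overlap2; lra.
have : l2sq a sigma <= 2 * l2sq a rho + 2 * del ^+ 2 * l2sq a psi.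
  rewrite /l2sq !mulr_sumr -big_split/=; apply: ler_sum => x _; rewrite rhoE.
  by have := sqr_ge0 (sigma x + 2 * (del * psi x)); lra.
by rewrite psi1; lra.
Qed.

Lemma eigenvalue_perturbation :
  m * `|lam - mu - l2dot a rho psi| <= 20 * l2sq a rho.
Proof.
rewrite l2dot_residual l2dotxx psi1.
rewrite (_ : lam - mu - _ = lam - l2dot a (schrodinger V psi) psi); last by ring.
by have := rayleigh_quotient_defect; have := l2sq_sigma_le; lra.
Qed.

Lemma eigenvector_perturbation :
  m ^+ 2 * l2sq a (fun x => phi x - psi x) <= 160 * l2sq a rho.
Proof. by have := eigenvector_defect; have := l2sq_sigma_le; lra. Qed.

End perturbation.

Section transplantation.
Context {R : realType} {d : nat}.
Variables (r RR m lam lbar : R) (U V phi phibar : Zpt d -> R) (x0 : Zpt d).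
Local Notation deg := (2 * d%:R).
Hypotheses (r0 : 0 < r) (x0R : inbox (RR - r) x0).
Hypothesis gs_bar : ground_state r U lbar phibar.

Definition transplant (f : Zpt d -> R) (x : Zpt d) : R := f (x - x0).

Definition mismatch (y : Zpt d) : R := V (y + x0) - V x0 - U y.

(* The second term bounds what [phibar] leaks through the boundary of the small box. *)
Definition transplant_error : R :=
  \sum_(y <- box d r) mismatch y ^+ 2 * phibar y ^+ 2 +
  2 * deg ^+ 2 / r * \sum_(y <- box d r) (l1norm y).+1%:R * phibar y ^+ 2.

Local Notation psi := (transplant phibar).
Local Notation rho := (residual V (lbar + V x0) psi).

Let phibar_supp : box_supported r phibar. Proof. by case: gs_bar => -[]. Qed.

Let inbox_translate y : inbox r y -> inbox RR (y + x0).
Proof. by move=> yr; have := inboxD yr x0R; rewrite addrC subrK. Qed.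

Let sum_transplant h : box_supported r h ->
  \sum_(x <- box d RR) h (x - x0) = \sum_(y <- box d r) h y.
Proof.
move=> hr; apply: sum_box_translate => // y hy.
exact: inbox_translate (box_supported_neq0 hr hy).
Qed.

Let transplant_supported h : box_supported r h -> box_supported RR (transplant h).
Proof.
by move=> hr x; apply: contraNeq => /(box_supported_neq0 hr)/inbox_translate; rewrite subrK.
Qed.

Lemma l2sq_transplant : l2sq RR psi = 1.
Proof.
have [_ _ <-] := gs_bar; apply: (sum_transplant (h := fun y => phibar y ^+ 2)) => y.
by move=> /phibar_supp ->; rewrite expr0n.
Qed.

Lemma residual_transplant_in x : inbox r (x - x0) ->
  rho x = mismatch (x - x0) * phibar (x - x0).
Proof.
have [[_ _ eig] _ _] := gs_bar; move=> /eig.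
rewrite /residual !schrodingerE /transplant nbsum_translate lapE /mismatch subrK.
lra.
Qed.

Lemma residual_transplant_out x : ~~ inbox r (x - x0) -> rho x = nbsum phibar (x - x0).
Proof.
move=> /phibar_supp xr; rewrite /residual schrodingerE /transplant nbsum_translate xr.
by rewrite !mulr0 addr0 subr0.
Qed.

Lemma l2sq_residual_transplant_le : l2sq RR rho <= transplant_error.
Proof.
pose F y := mismatch y ^+ 2 * phibar y ^+ 2.
pose h y := (l1norm y).+1%:R * phibar y ^+ 2.
have F0 y : 0 <= F y by rewrite /F mulr_ge0 ?sqr_ge0.
have h0 y : 0 <= h y by rewrite /h mulr_ge0 ?sqr_ge0.
have [F_supp h_supp] : box_supported r F /\ box_supported r h.
  by split=> y /phibar_supp; rewrite /F /h => ->; rewrite expr0n mulr0.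
have c0 : 0 <= deg * (2 / r) by rewrite !mulr_ge0// invr_ge0 ltW.
have rho_le x : rho x ^+ 2 <= F (x - x0) + deg * (2 / r * nbsum (transplant h) x).
  rewrite nbsum_translate.
  have [xr|xr] := boolP (inbox r (x - x0)).
    by rewrite residual_transplant_in// exprMn lerDl mulrA mulr_ge0// nbsum_ge0.
  by rewrite residual_transplant_out// ler_wpDl// nbsum_notin_box_le.
apply: (@le_trans _ _ (\sum_(x <- box d RR) F (x - x0) +
    deg * (2 / r * \sum_(x <- box d RR) nbsum (transplant h) x))).
  by rewrite !mulr_sumr -big_split/=; apply: ler_sum => x _; exact: rho_le.
rewrite sum_transplant//; apply: lerD => //.
rewrite expr2 -(sum_transplant h_supp).
have := sum_nbsum_le (transplant_supported h_supp) (fun x => h0 (x - x0)).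
by move=> /(ler_wpM2l c0); rewrite /transplant; lra.
Qed.

Lemma l2dot_residual_transplant :
  l2dot RR rho psi = \sum_(y <- box d r) mismatch y * phibar y ^+ 2.
Proof.
rewrite -(sum_transplant (h := fun y => mismatch y * phibar y ^+ 2)); last first.
  by move=> y /phibar_supp ->; rewrite expr0n mulr0.
apply: eq_bigr => x _; have [xr|/phibar_supp xr] := boolP (inbox r (x - x0)).
  by rewrite residual_transplant_in// /transplant; ring.
by rewrite /transplant xr expr0n !mulr0.
Qed.

Hypotheses (m0 : 0 < m) (degm : 2 * deg <= m).
Hypothesis peakU : isolated_peak r U 0 m.
Hypothesis peakV : isolated_peak RR V x0 m.
Hypothesis gs_phi : ground_state RR V lam phi.

Let psi0 x : 0 <= psi x. Proof. by have [_ phibar0 _] := gs_bar; exact: phibar0. Qed.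

Let psi_peak : 2^-1 <= psi x0 ^+ 2.
Proof. by rewrite /transplant subrr (ground_state_peak_ge gs_bar peakU). Qed.

Lemma transplant_eigenvalue :
  m * `|lam - lbar - V x0 - \sum_(y <- box d r) mismatch y * phibar y ^+ 2| <=
  20 * transplant_error.
Proof.
have := eigenvalue_perturbation m0 degm peakV gs_phi psi0
  (transplant_supported phibar_supp) l2sq_transplant psi_peak (lbar + V x0).
rewrite l2dot_residual_transplant opprD addrA => /le_trans; apply.
by rewrite ler_pM2l// l2sq_residual_transplant_le.
Qed.

Lemma transplant_eigenvector :
  m ^+ 2 * l2sq RR (fun x => phi x - phibar (x - x0)) <= 160 * transplant_error.
Proof.
have := eigenvector_perturbation m0 degm peakV gs_phi psi0
  (transplant_supported phibar_supp) l2sq_transplant psi_peak (lbar + V x0).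
by move/le_trans; apply; rewrite ler_pM2l// l2sq_residual_transplant_le.
Qed.

End transplantation.

Section deep_wells.
Context {R : realType}.
Variable d : nat.
Implicit Types (a b c eps r theta : R).
Local Notation deg := (2 * d%:R).
Local Notation lattice_const := (2 * 3 ^+ d).

Definition decay_rate c : R := 2 * deg / c.

Record deep_regime theta b c eps a r : Prop := DeepRegime {
  deep_gt0 : 0 < eps;
  deep_le1 : eps <= 1;
  deep_height_ge1 : 1 <= a;
  deep_height_le_radius : a <= r;
  deep_fluctuation_le : 5 * theta <= 2 * a;
  deep_decay : 2 * (decay_rate c * eps) <= 1;
  deep_summable : b ^+ 2 * decay_rate c ^+ 2 * eps <= 2^-1 }.

Definition error_const theta b c : R :=
  4 * (lattice_const * b * decay_rate c ^+ 2) +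
  2 * (theta ^+ 2 * lattice_const * b ^+ 2 * decay_rate c ^+ 2) +
  2 * deg ^+ 2 * (1 + lattice_const).

Definition eigenvalue_const theta b c : R :=
  40 / c * error_const theta b c + theta * lattice_const * b * decay_rate c ^+ 2.

Definition eigenvector_const theta b c : R := Num.sqrt (640 * error_const theta b c) / c.

Variables (theta b c eps a r RR s eta lam lbar : R).
Variables (S z V phi phibar : Zpt d -> R) (x0 : Zpt d).

(* The theorem takes [eps = d_L / a_L], [b = exp c'], [s = xi(x0) - a_L], [z = zeta(x0 + .)]
   and [eta = eps `^ (1 - 2 kappa)]. *)
Hypotheses (c0 : 0 < c) (b1 : 1 <= b) (eta01 : 0 <= eta <= 1).
Hypothesis deep : deep_regime theta b c eps a r.
Hypothesis s_le : `|s| <= theta.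
Hypotheses (x0R : inbox (RR - r) x0) (S0 : S 0 = 0).
Hypothesis S_bounds : forall y : Zpt d, y != 0 -> c / eps <= S y <= b ^+ l1norm y / eps.
Hypothesis V_eq : forall y : Zpt d, V (y + x0) = V x0 + z y - (1 + s / a) * S y.
Hypothesis z_le : forall y : Zpt d, inbox (2 * RR) y -> `|z y| <= 10^-1 * S y.
Hypothesis z_sqr_le : forall y : Zpt d, inbox r y -> y != 0 ->
  z y ^+ 2 <= 2 / eps * (`|s| + a^-1) * (b * (eta / eps)) ^+ l1norm y.
Hypothesis gs_bar : ground_state r (fun y => - S y) lbar phibar.
Hypothesis gs_phi : ground_state RR V lam phi.

Local Notation K := (decay_rate c).
Local Notation target := (eta * `|s| + a^-1).

Let m : R := c / (2 * eps).

Let eps0 : 0 < eps. Proof. exact: deep_gt0 deep. Qed.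
Let a0 : 0 < a. Proof. exact: lt_le_trans (deep_height_ge1 deep). Qed.
Let r0 : 0 < r. Proof. exact: lt_le_trans (deep_height_le_radius deep). Qed.
Let theta0 : 0 <= theta. Proof. exact: le_trans s_le. Qed.
Let b0 : 0 < b. Proof. exact: lt_le_trans b1. Qed.
Let m0 : 0 < m. Proof. by rewrite divr_gt0// mulr_gt0. Qed.
Let lattice_const0 : 0 <= lattice_const :> R. Proof. by rewrite mulr_ge0 ?exprn_ge0. Qed.
Let K0 : 0 <= K. Proof. by rewrite divr_ge0 ?mulr_ge0// ltW. Qed.
Let eta0 : 0 <= eta. Proof. by case/andP: eta01. Qed.

Let deg_div_m : deg / m = K * eps.
Proof. by rewrite /m /decay_rate; field; rewrite !gt_eqF. Qed.

Let degm : 2 * deg <= m.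
Proof. by have := deep_decay deep; rewrite -deg_div_m (mulrA 2 deg) ler_pdivrMr// mul1r. Qed.

Let z0 : z 0 = 0.
Proof. by have := V_eq 0; rewrite add0r S0; lra. Qed.

Let S_ge0 y : 0 <= S y.
Proof.
have [->|/S_bounds/andP[+ _]] := eqVneq y 0; first by rewrite S0.
by apply: le_trans; rewrite divr_ge0// ltW.
Qed.

Let x0_inbox : inbox RR x0.
Proof. by apply: inbox_le x0R; have := r0; lra. Qed.

Let peakS : isolated_peak r (fun y => - S y) 0 m.
Proof.
split=> [|y _ /S_bounds/andP[Sy _]]; first by rewrite inbox0// ltW.
have : 2 * m = c / eps by rewrite /m; field; rewrite gt_eqF.
by rewrite S0; have := m0; lra.
Qed.

Let peakV : isolated_peak RR V x0 m.
Proof.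
split=> // x xR xx0; pose y := x - x0.
have y2R : inbox (2 * RR) y.
  by rewrite (_ : 2 * RR = RR + RR); [apply: inboxD; rewrite ?inboxN|ring].
have y0 : y != 0 by rewrite subr_eq0.
have := V_eq y; rewrite subrK => ->; have /andP[Sy _] := S_bounds y0.
have := z_le y2R; rewrite ler_norml => /andP[_ zy].
have drift : - (2 / 5) * S y <= s / a * S y.
  apply: ler_wpM2r => //; rewrite ler_pdivlMr//.
  by have := s_le; rewrite ler_norml => /andP[+ _]; have := deep_fluctuation_le deep; lra.
have : 2 * m = c / eps by rewrite /m; field; rewrite gt_eqF.
by lra.
Qed.

Let weighted_sum_le (w : Zpt d -> R) (k p : R) : 0 <= k -> 0 <= p ->
  p * (K * eps) ^+ 2 <= 2^-1 -> w 0 = 0 ->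
  (forall y, inbox r y -> y != 0 -> w y <= k * p ^+ l1norm y) ->
  \sum_(y <- box d r) w y * phibar y ^+ 2 <= k * (lattice_const * (p * (K * eps) ^+ 2)).
Proof. by rewrite -deg_div_m; exact: ground_state_weighted_sum_le gs_bar peakS m0. Qed.

Let b2_small : b ^+ 2 * (K * eps) ^+ 2 <= 2^-1.
Proof.
apply: le_trans (deep_summable deep).
have -> : b ^+ 2 * (K * eps) ^+ 2 = b ^+ 2 * K ^+ 2 * eps * eps by ring.
by rewrite ler_piMr ?(deep_le1 deep)// mulr_ge0 ?(ltW eps0)// -exprMn sqr_ge0.
Qed.

Let b_le_sqr : b <= b ^+ 2. Proof. by rewrite expr2 ler_peMl// ltW. Qed.

Let sum_S_le : \sum_(y <- box d r) S y * phibar y ^+ 2 <= lattice_const * b * K ^+ 2 * eps.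
Proof.
have -> : lattice_const * b * K ^+ 2 * eps = eps^-1 * (lattice_const * (b * (K * eps) ^+ 2)).
  by field; rewrite gt_eqF.
apply: weighted_sum_le; rewrite ?invr_ge0 ?(ltW eps0) ?(ltW b0)//.
- by apply: le_trans b2_small; apply: ler_wpM2r; first exact: sqr_ge0.
- by move=> y _ /S_bounds/andP[_]; rewrite mulrC.
Qed.

Let sum_S_sqr_le :
  \sum_(y <- box d r) S y ^+ 2 * phibar y ^+ 2 <= lattice_const * b ^+ 2 * K ^+ 2.
Proof.
have -> : lattice_const * b ^+ 2 * K ^+ 2 =
    eps^-1 ^+ 2 * (lattice_const * (b ^+ 2 * (K * eps) ^+ 2)).
  by field; rewrite gt_eqF.
apply: (weighted_sum_le (w := fun y => S y ^+ 2)); rewrite ?sqr_ge0 ?S0 ?expr0n//.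
move=> y _ /S_bounds/andP[_ Sy]; rewrite exprAC -exprMn mulrC.
by apply: lerXn2r; rewrite ?nnegrE ?divr_ge0 ?exprn_ge0 ?(ltW eps0) ?(ltW b0).
Qed.

Let sum_z_sqr_le :
  \sum_(y <- box d r) z y ^+ 2 * phibar y ^+ 2 <= 2 * (lattice_const * b * K ^+ 2) * target.
Proof.
have /andP[_ eta1] := eta01.
apply: (@le_trans _ _ (2 / eps * (`|s| + a^-1) *
    (lattice_const * (b * (eta / eps) * (K * eps) ^+ 2)))).
  apply: (weighted_sum_le (w := fun y => z y ^+ 2)); rewrite ?z0 ?expr0n//.
  - by rewrite mulr_ge0 ?divr_ge0 ?addr_ge0 ?invr_ge0 ?(ltW eps0) ?(ltW a0).
  - by rewrite mulr_ge0 ?divr_ge0 ?(ltW eps0) ?(ltW b0).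
  have -> : b * (eta / eps) * (K * eps) ^+ 2 = b * eta * (K ^+ 2 * eps).
    by field; rewrite gt_eqF.
  apply: le_trans (deep_summable deep) => //; rewrite -[leRHS]mulrA.
  apply: ler_wpM2r; first by rewrite mulr_ge0 ?sqr_ge0// ltW.
  by apply: le_trans b_le_sqr; rewrite ler_piMr// ltW.
have -> : 2 / eps * (`|s| + a^-1) * (lattice_const * (b * (eta / eps) * (K * eps) ^+ 2)) =
    2 * (lattice_const * b * K ^+ 2) * (eta * `|s| + eta * a^-1).
  by field; rewrite !gt_eqF.
apply: ler_wpM2l; last by rewrite lerD2l ler_piMl// invr_ge0 ltW.
by rewrite mulr_ge0// mulr_ge0 ?sqr_ge0// mulr_ge0// ltW.
Qed.

Let first_moment_le : \sum_(y <- box d r) (l1norm y).+1%:R * phibar y ^+ 2 <= 1 + lattice_const.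
Proof.
have [_ _ phibar1] := gs_bar.
under eq_bigr do rewrite -natr1 mulrDl mul1r addrC.
rewrite big_split -/(l2sq r phibar) phibar1 lerD2l; have q2 : 2 * (K * eps) ^+ 2 <= 2^-1.
  have q0 : 0 <= K * eps by rewrite mulr_ge0// ltW.
  by have := deep_decay deep; nra.
apply: (@le_trans _ _ (1 * (lattice_const * (2 * (K * eps) ^+ 2)))).
  apply: (weighted_sum_le (w := fun y => (l1norm y)%:R)); rewrite ?l1norm0//.
  by move=> y _ _; rewrite mul1r -natrX ler_nat ltnW// ltn_expl.
by rewrite mul1r ler_piMr//; lra.
Qed.

Local Notation W := (mismatch (fun y => - S y) V x0).

Let mismatchE y : W y = z y - s / a * S y.
Proof. by rewrite /mismatch V_eq; ring. Qed.

Let inv_height_le : a^-1 <= target. Proof. by rewrite lerDr mulr_ge0. Qed.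

Let sum_mismatch_sqr_le :
  \sum_(y <- box d r) W y ^+ 2 * phibar y ^+ 2 <=
  (4 * (lattice_const * b * K ^+ 2) +
   2 * (theta ^+ 2 * lattice_const * b ^+ 2 * K ^+ 2)) * target.
Proof.
apply: (@le_trans _ _ (2 * (\sum_(y <- box d r) z y ^+ 2 * phibar y ^+ 2) +
    2 * (s / a) ^+ 2 * \sum_(y <- box d r) S y ^+ 2 * phibar y ^+ 2)).
  rewrite !mulr_sumr -big_split/=; apply: ler_sum => y _; rewrite mismatchE.
  by have := sqr_ge0 ((z y + s / a * S y) * phibar y); lra.
have drift_le : (s / a) ^+ 2 <= theta ^+ 2 * a^-1.
  have ainv1 : a^-1 <= 1 by rewrite invf_le1// (deep_height_ge1 deep).
  rewrite exprMn; apply: ler_pM; rewrite ?sqr_ge0//.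
    by rewrite -(real_normK (num_real s)); apply: lerXn2r; rewrite ?nnegrE.
  by rewrite expr2 ler_piMr// invr_ge0 ltW.
have sum_ge0 : 0 <= lattice_const * b ^+ 2 * K ^+ 2.
  by have := mulr_ge0 lattice_const0 (sqr_ge0 (b * K)); lra.
have theta_target : theta ^+ 2 * a^-1 <= theta ^+ 2 * target.
  by apply: ler_wpM2l; rewrite ?sqr_ge0.
have := ler_wpM2l (mulr_ge0 (ler0n R 2) (sqr_ge0 (s / a))) sum_S_sqr_le.
have := ler_wpM2r sum_ge0 (le_trans drift_le theta_target).
by have := sum_z_sqr_le; lra.
Qed.

Lemma deep_transplant_error_le :
  transplant_error r (fun y => - S y) V phibar x0 <= error_const theta b c * target.
Proof.
rewrite [leRHS]mulrDl; apply: lerD; first exact: sum_mismatch_sqr_le.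
rewrite -mulrA -[leRHS]mulrA; apply: ler_wpM2l; first by rewrite mulr_ge0 ?sqr_ge0.
rewrite mulrC; apply: ler_pM first_moment_le _; rewrite ?invr_ge0 ?(ltW r0)//.
  by apply: sumr_ge0 => y _; rewrite mulr_ge0 ?sqr_ge0.
by apply: le_trans inv_height_le; rewrite lef_pV2 ?posrE// (deep_height_le_radius deep).
Qed.

Let error_const_ge0 : 0 <= error_const theta b c.
Proof.
have term1 : 0 <= lattice_const * b * K ^+ 2 by rewrite mulr_ge0 ?sqr_ge0// mulr_ge0// ltW.
have term2 : 0 <= theta ^+ 2 * lattice_const * b ^+ 2 * K ^+ 2.
  by have := mulr_ge0 lattice_const0 (sqr_ge0 (theta * b * K)); lra.
have term3 : 0 <= deg ^+ 2 * (1 + lattice_const) :> R by rewrite mulr_ge0 ?sqr_ge0 ?addr_ge0.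
by rewrite /error_const; lra.
Qed.

Lemma deep_well_eigenvalue :
  `|lam - lbar - (V x0 + \sum_(y <- box d r | y != 0) phibar y ^+ 2 * z y)| <=
  eigenvalue_const theta b c * eps * target.
Proof.
have := transplant_eigenvalue r0 x0R gs_bar m0 degm peakS peakV gs_phi.
pose S_sum := \sum_(y <- box d r) S y * phibar y ^+ 2.
pose z_sum := \sum_(y <- box d r | y != 0) phibar y ^+ 2 * z y.
have -> : \sum_(y <- box d r) W y * phibar y ^+ 2 = z_sum - s / a * S_sum.
  rewrite mulr_sumr [X in _ = X - _]big_mkcond -sumrB; apply: eq_bigr => y _.
  rewrite mismatchE mulrBl -(mulrA (s / a)) (mulrC (z y)).
  by case: eqVneq => [->|_] //=; rewrite z0 mulr0.
set defect := lam - lbar - V x0 - _ => defect_le.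
have -> : lam - lbar - (V x0 + z_sum) = defect - s / a * S_sum.
  by rewrite /defect; ring.
have drift_le : `|s / a * S_sum| <= theta * lattice_const * b * K ^+ 2 * eps * target.
  have S_sum0 : 0 <= S_sum by apply: sumr_ge0 => y _; rewrite mulr_ge0 ?sqr_ge0.
  rewrite !normrM normfV (gtr0_norm a0) (ger0_norm S_sum0) -mulrA.
  have -> : theta * lattice_const * b * K ^+ 2 * eps * target =
    theta * (target * (lattice_const * b * K ^+ 2 * eps)) by ring.
  apply: ler_pM => //; first by rewrite mulr_ge0 ?invr_ge0 ?(ltW a0).
  by apply: ler_pM inv_height_le sum_S_le; rewrite ?invr_ge0 ?(ltW a0).
have {}defect_le : `|defect| <= 40 / c * error_const theta b c * eps * target.
  rewrite -(ler_pM2l m0) (le_trans defect_le)//.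
  have -> : m * (40 / c * error_const theta b c * eps * target) =
      20 * (error_const theta b c * target).
    by rewrite /m; move: (error_const _ _ _) target => C t; field; rewrite !gt_eqF.
  by rewrite ler_pM2l// deep_transplant_error_le.
by apply: le_trans (ler_normB _ _) _; rewrite /eigenvalue_const; lra.
Qed.

Lemma deep_well_eigenvector :
  l2box RR (fun x => phi x - phibar (x - x0)) <=
  eigenvector_const theta b c * eps * Num.sqrt target.
Proof.
have := transplant_eigenvector r0 x0R gs_bar m0 degm peakS peakV gs_phi.
set diff := fun x => _; rewrite -ler_pdivlMl ?exprn_gt0// => diff_le.
have -> : eigenvector_const theta b c * eps * Num.sqrt target =
    Num.sqrt (m ^- 2 * (160 * (error_const theta b c * target))).
  have cV0 : 0 <= eps / c by rewrite divr_ge0 ?ltW.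
  have -> : m ^- 2 * (160 * (error_const theta b c * target)) =
      (eps / c) ^+ 2 * (640 * error_const theta b c * target).
    by rewrite /m; move: (error_const _ _ _) target => C t; field; rewrite !gt_eqF.
  have const0 := mulr_ge0 (ler0n R 640) error_const_ge0.
  rewrite (sqrtrM _ (sqr_ge0 _)) sqrtr_sqr (ger0_norm cV0) (sqrtrM _ const0).
  by rewrite /eigenvector_const; ring.
apply: ler_wsqrtr; apply: le_trans diff_le _.
by rewrite ler_pM2l ?invr_gt0 ?exprn_gt0// ler_pM2l// deep_transplant_error_le.
Qed.

End deep_wells.

Section gaussian_fields.
Context {R : realType} {dT : measure_display} {T : measurableType dT} {d : nat}.
Variables (P : probability T R) (xi : Zpt d -> T -> R) (v : Zpt d -> R).
Hypothesis gf : gaussian_field P xi v.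
Implicit Types (s : seq (Zpt d * R)) (x : Zpt d) (w : T).

Definition combination s w : R := \sum_(p <- s) p.2 * xi p.1 w.

Definition combination_variance s : R :=
  \sum_(p <- s) \sum_(q <- s) p.2 * q.2 * v (p.1 - q.1).

Lemma gaussian_field_variance s : 0 < combination_variance s ->
  ('V_P[combination s] = (combination_variance s)%:E)%E.
Proof.
have [mxi law] := gf; move=> var_gt0.
apply: gaussian_variance var_gt0 _ _ => [|A mA|A mA]; last 2 first.
- exact: law.
- pose s' := [seq (p.1, - p.2) | p <- s].
  have -> : \- combination s = fun w => \sum_(p <- s') p.2 * xi p.1 w.
    apply/funext => w; rewrite big_map /combination /= -sumrN.
    by apply: eq_bigr => p _; rewrite mulNr.
  rewrite [LHS](law s A mA) (law s' A mA) big_map; congr centred_gaussian_law.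
  apply: eq_bigr => p _; rewrite big_map.
  by apply: eq_bigr => q _; rewrite mulrNN.
- by apply: measurable_sum => p; exact: measurable_funM.
Qed.

Lemma variance_zeta x0 x : v 0 = 1 -> v (x - x0) * v (x0 - x) < 1 ->
  ('V_P[zeta xi v x0 x] = (1 - v (x - x0) * v (x0 - x))%:E)%E.
Proof.
move=> v0 v1; pose s := [:: (x, 1); (x0, - v (x - x0))].
have -> : zeta xi v x0 x = combination s.
  by apply/funext => w; rewrite /combination !big_cons big_nil/= /zeta; ring.
have var_s : combination_variance s = 1 - v (x - x0) * v (x0 - x).
  by rewrite /combination_variance !big_cons !big_nil/= !subrr v0; ring.
by rewrite gaussian_field_variance var_s// subr_gt0.
Qed.

End gaussian_fields.

Section covariance_bounds.
Context {R : realType} {d : nat}.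
Variables (c c' D : R) (v : Zpt d -> R).
Hypotheses (c0 : 0 < c) (c'0 : 0 < c') (D0 : 0 < D) (v_ge0 : forall x, 0 <= v x).
Hypothesis v_bounds : forall x : Zpt d, x != 0 ->
  1 - expR (c' * enorm x) / D <= v x <= 1 - c / D.

Lemma one_sub_covariance_bounds (x : Zpt d) : x != 0 ->
  c / D <= 1 - v x <= expR c' ^+ l1norm x / D.
Proof.
move=> /v_bounds/andP[v_ge v_le]; apply/andP; split; first by lra.
apply: (@le_trans _ _ (expR (c' * enorm x) / D)); first by lra.
rewrite ler_pM2r ?invr_gt0// -expRM_natr ler_expR ler_pM2l//.
exact: enorm_le_l1norm.
Qed.

Lemma one_sub_covariance_sqr_bounds (x : Zpt d) : x != 0 ->
  0 < 1 - v x * v (- x) <= 2 / D * expR c' ^+ l1norm x.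
Proof.
move=> x0; have Nx0 : - x != 0 by rewrite oppr_eq0.
have /andP[] := one_sub_covariance_bounds x0.
have /andP[] := one_sub_covariance_bounds Nx0; rewrite l1normN.
have := v_ge0 x; have := v_ge0 (- x); have := divr_gt0 c0 D0.
rewrite -mulrA (mulrC D^-1); move: (v x) (v (- x)) => u u' *.
by apply/andP; split; nra.
Qed.

End covariance_bounds.

Section zeta_bound.
Context {R : realType} {dT : measure_display} {T : measurableType dT} {d : nat}.

Lemma sqr_powR_rescale_le (a D kappa u : R) (k : nat) : 0 < D -> D <= a -> 0 < kappa ->
  u <= k%:R ->
  ((a / D) `^ (kappa * u)) ^+ 2 <= ((D / a) `^ (1 - 2 * kappa) / (D / a)) ^+ k.
Proof.
move=> D0 Da kappa0 uk; have a0 := lt_le_trans D0 Da.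
have aD1 : 1 <= a / D by rewrite ler_pdivlMr// mul1r.
have -> : (D / a) `^ (1 - 2 * kappa) / (D / a) = (a / D) `^ (2 * kappa).
  have eps0 : 0 < D / a by rewrite divr_gt0.
  have invE : (D / a)^-1 = (D / a) `^ (-1) by rewrite powR_inv1// ltW.
  rewrite -[a / D]invf_div invE -powRrM -powRD ?(gt_eqF eps0) ?implybT//.
  by congr powR; ring.
rewrite -(powR_mulrn 2 (powR_ge0 _ _)) -(powR_mulrn k (powR_ge0 _ _)) -!powRrM.
by apply: ler_powR => //; have := ler_wpM2l (ltW kappa0) uk; lra.
Qed.

Lemma sqr_le_of_normalized_le (z V p M : R) : 0 < V -> 0 <= p -> 0 <= M ->
  `|z| / Num.sqrt V <= p * Num.sqrt M -> z ^+ 2 <= p ^+ 2 * M * V.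
Proof.
move=> V0 p0 M0; rewrite ler_pdivrMr ?sqrtr_gt0// => z_le.
rewrite -(real_normK (num_real z)) -(sqr_sqrtr M0) -(sqr_sqrtr (ltW V0)) -!exprMn.
by apply: lerXn2r; rewrite ?nnegrE// !mulr_ge0.
Qed.

Lemma zeta_sqr_le (P : probability T R) (xi : Zpt d -> T -> R) (v : Zpt d -> R)
    (a D c c' kappa : R) (x0 x : Zpt d) (w : T) :
  gaussian_field P xi v -> v 0 = 1 -> (forall y, 0 <= v y) ->
  0 < D -> D <= a -> 0 < c -> 0 < c' -> 0 < kappa ->
  (forall y : Zpt d, y != 0 -> 1 - expR (c' * enorm y) / D <= v y <= 1 - c / D) ->
  x != x0 ->
  `|zeta xi v x0 x w| / Num.sqrt (fine ('V_P[zeta xi v x0 x])%E)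
     <= (a / D) `^ (kappa * enorm (x - x0)) *
        Num.sqrt (Num.max 1 (`|xi x0 w - a| * a)) ->
  zeta xi v x0 x w ^+ 2 <= 2 / (D / a) * (`|xi x0 w - a| + a^-1) *
    (expR c' * ((D / a) `^ (1 - 2 * kappa) / (D / a))) ^+ l1norm (x - x0).
Proof.
move=> gf v0 v_ge0 D0 Da c0 c'0 kappa0 v_bounds xx0 z_le.
have a0 := lt_le_trans D0 Da; set y := x - x0; set s := `|xi x0 w - a|.
have y0 : y != 0 by rewrite subr_eq0.
have /andP[var_gt0 var_le] := one_sub_covariance_sqr_bounds c0 c'0 D0 v_ge0 v_bounds y0.
have varE : ('V_P[zeta xi v x0 x] = (1 - v y * v (- y))%:E)%E.
  by rewrite opprB (variance_zeta gf)// -subr_gt0 -[x0 - x]opprB.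
have s0 : 0 <= s * a by rewrite mulr_ge0 ?normr_ge0 ?(ltW a0).
have max_le : Num.max 1 (s * a) <= 1 + s * a by rewrite ge_max lerDl lerDr s0 ler01.
have max0 : 0 <= Num.max 1 (s * a) by rewrite le_max ler01.
move: z_le; rewrite varE /= => z_le.
apply: le_trans (sqr_le_of_normalized_le var_gt0 (powR_ge0 _ _) max0 z_le) _.
have pow_le := sqr_powR_rescale_le D0 Da kappa0 (@enorm_le_l1norm R d y).
rewrite (exprMn (l1norm y)); set g := (_ / (D / a)) ^+ _ in pow_le *.
have -> : 2 / (D / a) * (s + a^-1) * (expR c' ^+ l1norm y * g) =
    g * (1 + s * a) * (2 / D * expR c' ^+ l1norm y) by field; rewrite !gt_eqF.
have pow0 := sqr_ge0 ((a / D) `^ (kappa * enorm y)).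
by apply: ler_pM; [exact: mulr_ge0|exact: ltW|exact: ler_pM|].
Qed.

End zeta_bound.

Section comparison_const.
Context {R : realType}.
Variables (d : nat) (theta b c : R).

Definition comparison_const : R :=
  Num.max 1 (Num.max (eigenvalue_const d theta b c) (eigenvector_const d theta b c)).

Lemma comparison_const_gt0 : 0 < comparison_const.
Proof. by rewrite lt_max ltr01. Qed.

Lemma eigenvalue_const_le : eigenvalue_const d theta b c <= comparison_const.
Proof. by rewrite !le_max lexx orbT. Qed.

Lemma eigenvector_const_le : eigenvector_const d theta b c <= comparison_const.
Proof. by rewrite !le_max lexx !orbT. Qed.

End comparison_const.

Section fixed_scale.
Context {R : realType} {dT : measure_display} {T : measurableType dT} {d : nat}.
Variables (P : probability T R) (xi : Zpt d -> T -> R) (v : Zpt d -> R).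
Variables (a D r RR c c' kappa lbar lam : R) (phibar phi : Zpt d -> R) (x0 : Zpt d) (w : T).
Local Notation theta := ((2 * d + 1)%:R : R).
Local Notation eps := (D / a).
Local Notation s := (xi x0 w - a).
Local Notation eta := (eps `^ (1 - 2 * kappa)).

Hypotheses (d0 : (0 < d)%N) (c0 : 0 < c) (c'0 : 0 < c').
Hypothesis kappa_bounds : 0 < kappa < 3^-1.
Hypotheses (gf : gaussian_field P xi v) (v0 : v 0 = 1) (v_ge0 : forall x, 0 <= v x).
Hypothesis v_bounds : forall x : Zpt d, x != 0 ->
  1 - expR (c' * enorm x) / D <= v x <= 1 - c / D.
Hypothesis deep : deep_regime d theta (expR c') c eps a r.
Hypotheses (x0R : inbox (RR - r) x0) (event : Eevent P xi v a D RR kappa x0 w).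
Hypothesis gs_bar : ground_state r (fun x => - (a * (1 - v x))) lbar phibar.
Hypothesis gs_phi : ground_state RR (fun x => xi x w) lam phi.

Let S (y : Zpt d) : R := a * (1 - v y).
Let z (y : Zpt d) : R := zeta xi v x0 (y + x0) w.

Let a0 : 0 < a. Proof. exact: lt_le_trans (deep_height_ge1 deep). Qed.

Let eps0 : 0 < eps. Proof. exact: deep_gt0 deep. Qed.

Let D0 : 0 < D. Proof. by have := eps0; rewrite pmulr_lgt0 ?invr_gt0. Qed.

Let b1 : 1 <= expR c'. Proof. by rewrite -[leLHS]expR0 ler_expR ltW. Qed.

Let eta01 : 0 <= eta <= 1.
Proof.
have /andP[_ kappa3] := kappa_bounds.
rewrite powR_ge0/= [leRHS](_ : 1 = 1 `^ (1 - 2 * kappa) :> R); last by rewrite powR1.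
by apply: ge0_ler_powR; rewrite ?nnegrE ?(ltW eps0) ?(deep_le1 deep)//; lra.
Qed.

Let s_le : `|s| <= theta. Proof. by case: event => /ltW. Qed.

Let S0 : S 0 = 0. Proof. by rewrite /S v0 subrr mulr0. Qed.

Let S_bounds (y : Zpt d) : y != 0 -> c / eps <= S y <= expR c' ^+ l1norm y / eps.
Proof.
move=> /(one_sub_covariance_bounds c'0 D0 v_bounds)/andP[v_le v_ge].
have div_eps (u : R) : u / eps = a * (u / D) by field; rewrite !gt_eqF.
by rewrite !div_eps !ler_pM2l// v_le.
Qed.

Let xi_eq (y : Zpt d) : xi (y + x0) w = xi x0 w + z y - (1 + s / a) * S y.
Proof. by rewrite /z /S /zeta addrK; field; rewrite gt_eqF. Qed.

Let z_le (y : Zpt d) : inbox (2 * RR) y -> `|z y| <= 10^-1 * S y.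
Proof. by have [_ + _] := event => /(_ (y + x0)); rewrite addrK; exact. Qed.

Let radius_le : r <= RR.
Proof.
move/inboxP : x0R => /(_ (Ordinal d0))/(le_trans (normr_ge0 _)).
by rewrite pmulr_lge0 ?invr_gt0// subr_ge0.
Qed.

Let z_sqr_le (y : Zpt d) : inbox r y -> y != 0 ->
  z y ^+ 2 <= 2 / eps * (`|s| + a^-1) * (expR c' * (eta / eps)) ^+ l1norm y.
Proof.
move=> yr y0; have [_ _ /(_ (y + x0))] := event; rewrite addrK.
have yx0 : y + x0 != x0 by rewrite -subr_eq0 addrK.
move=> /(_ (inbox_le radius_le yr) yx0) z_normalized.
have Da : D <= a by have := deep_le1 deep; rewrite ler_pdivrMr// mul1r.
have /andP[kappa0 _] := kappa_bounds.
have := zeta_sqr_le gf v0 v_ge0 D0 Da c0 c'0 kappa0 v_bounds yx0.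
by rewrite addrK; exact.
Qed.

Lemma fixed_scale_comparison :
  `|lam - lbar - Xi xi v r phibar x0 w| <=
    comparison_const d theta (expR c') c * eps * (eta * `|s| + a^-1) /\
  l2box RR (fun x => phi x - phibar (x - x0)) <=
    comparison_const d theta (expR c') c * eps * Num.sqrt (eta * `|s| + a^-1).
Proof.
have target0 : 0 <= eta * `|s| + a^-1.
  by rewrite addr_ge0 ?mulr_ge0 ?powR_ge0 ?invr_ge0 ?(ltW a0).
split.
- apply: le_trans (deep_well_eigenvalue c0 b1 eta01 deep s_le x0R S0 S_bounds
    xi_eq z_le z_sqr_le gs_bar gs_phi) _.
  by rewrite !ler_wpM2r ?(ltW eps0)// eigenvalue_const_le.
- apply: le_trans (deep_well_eigenvector c0 b1 eta01 deep s_le x0R S0 S_bounds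
    xi_eq z_le z_sqr_le gs_bar gs_phi) _.
  by rewrite !ler_wpM2r ?sqrtr_ge0 ?(ltW eps0)// eigenvector_const_le.
Qed.

End fixed_scale.

Section large_scales.
Context {R : realType} {d : nat}.

Definition axis_point (i : 'I_d) (N : nat) : Zpt d :=
  [ffun j => if j == i then N%:Z else 0].

Lemma enorm_axis_point i N : enorm (axis_point i N) = N%:R :> R.
Proof.
rewrite /enorm (bigD1 i)//= big1 => [|j ji]; last by rewrite ffunE (negbTE ji) expr0n.
by rewrite ffunE eqxx addr0 sqrtr_sqr ger0_norm.
Qed.

Lemma enorm0 : enorm (0 : Zpt d) = 0 :> R.
Proof. by rewrite /enorm big1 ?sqrtr0// => i _; rewrite ffunE expr0n. Qed.

(* A negative [D] would make [v >= 1] off the origin, against the decay of [v]. *)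
Lemma covariance_scale_gt0 (D c' rad : R) (v : Zpt d -> R) : (0 < d)%N -> D != 0 ->
  (forall x, x != 0 -> 1 - expR (c' * enorm x) / D <= v x) ->
  (forall x, rad <= enorm x -> v x * ln (enorm x) <= 2^-1) -> 0 < D.
Proof.
move=> d0 D0 v_ge v_decay; rewrite lt_neqAle eq_sym D0/= leNgt; apply/negP => D_lt0.
pose t := Num.max rad (expR 1); pose x := axis_point (Ordinal d0) (Num.bound t).
have [rad_x e_x] : rad <= enorm x /\ expR 1 <= enorm x :> R.
  apply/andP; rewrite -ge_max -/t enorm_axis_point ltW// archi_boundP//.
  by rewrite le_max expR_ge0 orbT.
have ln_x : 1 <= ln (enorm x : R).
  have x_gt0 : 0 < enorm x :> R := lt_le_trans (expR_gt0 1) e_x.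
  by rewrite -[leLHS](expRK 1) ler_ln// posrE expR_gt0.
have x0 : x != 0.
  by apply: contraTneq e_x => ->; rewrite enorm0 leNgt expR_gt0.
have v_x : 1 <= v x.
  apply: le_trans (v_ge _ x0); rewrite lerBrDr gerDl.
  by rewrite mulr_ge0_le0 ?expR_ge0// invr_le0 ltW.
by have := v_decay x rad_x; nra.
Qed.

Lemma near_covariance_scale_ge1 (D rad : nat -> R) (c' : R) (v : nat -> Zpt d -> R) :
  (0 < d)%N -> (\forall L \near \oo, D L != 0) ->
  (forall L x, x != 0 -> 1 - expR (c' * enorm x) / D L <= v L x) ->
  (\forall L \near \oo, forall x, rad L <= enorm x -> v L x * ln (enorm x) <= 2^-1) ->
  (forall L x, 0 <= v L x) -> (forall L, exists x, v L x = 1 - (D L)^-1) ->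
  \forall L \near \oo, 1 <= D L.
Proof.
move=> d0 D_neq0 v_ge v_decay v_ge0 v_sup; near=> L.
have D0 : 0 < D L.
  by apply: (covariance_scale_gt0 (rad := rad L) d0 _ (v_ge L)); near: L.
by have [x vx] := v_sup L; have := v_ge0 L x; rewrite vx subr_ge0 invf_le1.
Unshelve. all: by end_near.
Qed.

Lemma negl_mul_le (u w : nat -> R) (k e : R) : negl u w -> 0 < e ->
  \forall L \near \oo, k * (u L / w L) <= e.
Proof.
move=> [_ uw] e0.
have : (fun L => k * (u L / w L)) @ \oo --> (k * 0 : R) by apply: cvgM uw; exact: cvg_cst.
rewrite mulr0 => /cvgrPdist_le/(_ e e0); apply: filterS => L; rewrite sub0r normrN.
exact: le_trans (ler_norm _).
Qed.

Lemma near_deep_regime (theta b c : R) (a D r : nat -> R) : 0 <= theta ->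
  negl D a -> (\forall L \near \oo, 1 <= D L) -> (\forall L \near \oo, 0 < a L) ->
  (\forall L \near \oo, ln (a L) <= ln (r L)) ->
  \forall L \near \oo, deep_regime d theta b c (D L / a L) (a L) (r L).
Proof.
move=> theta0 Da D1 a0 ar.
have eps_le (k e : R) : 0 < e -> \forall L \near \oo, k * (D L / a L) <= e.
  exact: negl_mul_le.
near=> L.
have D1L : 1 <= D L by near: L.
have a0L : 0 < a L by near: L.
have eps0 : 0 < D L / a L by rewrite divr_gt0// (lt_le_trans _ D1L).
have eps_half : 1 * (D L / a L) <= 2^-1 by near: L; apply: eps_le; rewrite invr_gt0.
have a2 : 2 <= a L by move: eps_half; rewrite mul1r ler_pdivrMr//; lra.
split => //; try lra.
- have lnr : ln (a L) <= ln (r L) by near: L.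
  have r0 : 0 < r L.
    rewrite ltNge; apply/negP => /ln0 r0; move: lnr; rewrite r0 leNgt ln_gt0//; lra.
  by rewrite -ler_ln.
- have : 5 * theta * (D L / a L) <= 2 by near: L; exact: eps_le.
  by rewrite mulrA ler_pdivrMr//; apply: le_trans; rewrite ler_peMr ?mulr_ge0.
- rewrite mulrA; near: L; exact: eps_le.
- by near: L; apply: eps_le; rewrite invr_gt0.
Unshelve. all: by end_near.
Qed.

End large_scales.

Theorem theorem4p2 (R : realType) (d : nat) (kappa : R)
    (dT : measure_display) (T : measurableType dT)
    (P : nat -> probability T R)
    (xi : nat -> Zpt d -> T -> R) (v : nat -> Zpt d -> R)
    (dL a RL rL lbar : nat -> R) (phibar : nat -> Zpt d -> R) :
  (0 < d)%N ->
  0 < kappa < 3^-1 ->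
  (* centred stationary Gaussian field, unit variance, non-negative covariance v_L *)
  (forall L, gaussian_field (P L) (xi L) (v L)) ->
  (forall L, v L 0 = 1) ->
  (forall L x, 0 <= v L x) ->
  (* (I) *)
  (forall e : R, 0 < e -> exists L1 : nat, forall L : nat, (L1 <= L)%N ->
     forall x : Zpt d, expR (Num.sqrt (ln (L%:R : R))) <= enorm x ->
       v L x * ln (enorm x) <= e) ->
  (* d_L : sup_{|x|=1} v_L(x) = 1 - 1/d_L *)
  (forall L, (forall x : Zpt d, enorm x = 1 :> R -> v L x <= 1 - (dL L)^-1) /\
             (exists x : Zpt d, enorm x = 1 :> R /\ v L x = 1 - (dL L)^-1)) ->
  (* (II) *)
  (exists c c' : R, 0 < c /\ 0 < c' /\
     forall L (x : Zpt d), x != 0 ->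
       1 - expR (c' * enorm x) / dL L <= v L x <= 1 - c / dL L) ->
  (* a_L : P(xi_L(0) > a_L) = L^{-d} *)
  (forall L : nat, (2 <= L)%N ->
     P L [set w | a L < xi L 0 w] = ((L%:R : R) ^- d)%:E) ->
  (* scales R_L, r_L *)
  negl a (fun L => ln (RL L)) ->
  negl (fun L => ln (RL L)) (fun L => a L ^+ 2 / dL L) ->
  (forall L : nat, (2 <= L)%N -> ln (a L) <= ln (rL L)) ->
  negl (fun L => ln (rL L)) (fun L => Num.sqrt (a L)) ->
  (* principal eigenpair of Delta - S_L on Q_{r_L}, S_L = a_L (1 - v_L) *)
  (forall L, principal_eigenpair (rL L) (fun x => - (a L * (1 - v L x)))
                                 (lbar L) (phibar L)) ->
  (* standing assumptions: d_L << a_L, tau_L << a_L^{-1} (a_L/d_L)^{1/2} *)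
  negl dL a ->
  negl (fun L => Num.sqrt (fine ('V_(P L)[Phi (xi L) (v L) (rL L) (phibar L) 0%R])%E))
       (fun L => (a L)^-1 * Num.sqrt (a L / dL L)) ->
  exists C : R, 0 < C /\
  exists L0 : nat, (1 <= L0)%N /\
  forall L : nat, (L0 <= L)%N ->
  forall x0 : Zpt d, inbox (RL L - rL L) x0 ->
  forall w : T, Eevent (P L) (xi L) (v L) (a L) (dL L) (RL L) kappa x0 w ->
  forall (lam : R) (phi : Zpt d -> R),
    principal_eigenpair (RL L) (fun x => xi L x w) lam phi ->
    `|lam - lbar L - Xi (xi L) (v L) (rL L) (phibar L) x0 w|
      <= C * (dL L / a L) *
         ((dL L / a L) `^ (1 - 2 * kappa) * `|xi L x0 w - a L| + (a L)^-1)
    /\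
    l2box (RL L) (fun x => phi x - phibar L (x - x0))
      <= C * (dL L / a L) *
         Num.sqrt ((dL L / a L) `^ (1 - 2 * kappa) * `|xi L x0 w - a L| + (a L)^-1).
Proof.
move=> d0 kappa_bounds gf v0 v_ge0 v_decay dL_sup [c [c' [c0 [c'0 v_bounds]]]] _ _ lnR_negl
  ln_a_le lnr_negl eig_bar dL_negl _.
pose theta : R := (2 * d + 1)%:R.
exists (comparison_const d theta (expR c') c); split; first exact: comparison_const_gt0.
have dL_neq0 : \forall L \near \oo, dL L != 0.
  by case: lnR_negl => + _; apply: filterS => L; apply: contraNneq => ->; rewrite invr0 mulr0.
have dL_ge1 : \forall L \near \oo, 1 <= dL L.
  apply: (near_covariance_scale_ge1 (rad := fun L => expR (Num.sqrt (ln L%:R))) d0 dL_neq0).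
  - by move=> L x /(v_bounds L)/andP[+ _]; exact.
  - by have [|L1 decayL1] := v_decay 2^-1; [rewrite invr_gt0|exists L1].
  - exact: v_ge0.
  - by move=> L; have [_ [x [_ vx]]] := dL_sup L; exists x.
have a_gt0 : \forall L \near \oo, 0 < a L.
  by case: lnr_negl => + _; apply: filterS => L; rewrite sqrtr_eq0 -ltNge.
have ln_a_near : \forall L \near \oo, ln (a L) <= ln (rL L) by exists 2%N.
have [L0 _ deep] := near_deep_regime (d := d) (expR c') c (ler0n R _ : 0 <= theta) dL_negl
  dL_ge1 a_gt0 ln_a_near.
exists L0.+1; split=> // L /ltnW/deep deepL x0 x0R w event lam phi eig_phi.
exact: (fixed_scale_comparison d0 c0 c'0 kappa_bounds (gf L) (v0 L) (v_ge0 L) (v_bounds L)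
  deepL x0R event (principal_ground_state (eig_bar L)) (principal_ground_state eig_phi)).
Qed.
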